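(* Let $f,g:\mathbb{X}\to\overline{\mathbb{R}}$ satisfy: (i) $f$ is proper and lower semicontinuous, and is continuously differentiable on an open set $\mathcal{O}\supset{\rm dom}\,g\neq\emptyset$ with $\nabla f$ strictly continuous (i.e. locally Lipschitz) on $\mathcal{O}$; (ii) $g$ is proper, lower semicontinuous and bounded from below; (iii) $F:=f+g$ is bounded from below. Let $\delta\ge0$ and $F_\delta(x,u):=F(x)+\frac{\delta}{2}\|x-u\|^2$ for $(x,u)\in\mathbb{X}\times\mathbb{X}$. Let $\{z^k\}_{k\in\mathbb{N}}$, $z^k=(x^k,x^{k-1})$, be the (infinite) sequence generated by the nonmonotone line search proximal gradient method with extrapolation described in the context. Suppose that $\mathcal{L}_{F_\delta}(z^0):=\{z\in\mathbb{X}\times\mathbb{X}: F_\delta(z)\le F_\delta(z^0)\}$ is bounded and that $F_\delta$ is a KL function. Then $\{z^k\}_{k\in\mathbb{N}}$ converges to a point of the form $(x^*,x^* )$, and $x^*$ is a stationary point of $F$, i.e. $0\in\nabla f(x^* )+\partial g(x^* )$. If moreover $F$ is a KL function of exponent $\theta\in[1/2,1)$, then there exist $C>0$ and $q\in(0,1)$ such that for all $k$ large enough, $$\|x^k-x^*\|\le\sum_{j=k}^\infty\|x^{j+1}-x^j\|\le\begin{cases}C q^k&\text{if }\theta=1/2,\\ C k^{\frac{1-\theta}{1-2\theta}}&\text{if }\theta\in(1/2,1).\end{cases}$$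
   Context: $\mathbb{X}$ is a finite-dimensional real inner product space with induced norm $\|\cdot\|$, $\overline{\mathbb{R}}=(-\infty,\infty]$, $\mathbb{N}=\{0,1,2,\dots\}$, $\partial$ is the limiting (Mordukhovich) subdifferential, ${\rm dist}(0,\emptyset)=\infty$. Algorithm. Input: $m\in\mathbb{N}$, $\delta\ge0$, $\alpha\in(0,1)$, $0<\gamma_{\min}\le\gamma_{\max}<\infty$, $\beta_{\max}\in[0,1]$, $\varrho>1$, $\nu\in(0,1/\varrho)$, $x^0\in{\rm dom}\,g$. Let $x^{-1}=x^0$, $z^0=(x^0,x^{-1})$. At iteration $k=0,1,2,\dots$: choose $\beta_{k,0}\in[0,\beta_{\max}]$ and $\gamma_{k,0}\in[\gamma_{\min},\gamma_{\max}]$. Inner loop: for $j=0,1,2,\dots$, let $\beta_{k,j}=\beta_{k,0}\nu^j$, $\gamma_{k,j}=\gamma_{k,0}\varrho^j$, $y^{k,j}=x^k+\beta_{k,j}(x^k-x^{k-1})$, and compute an optimal solution $x^{k,j}$ of $$\min_{x\in\mathbb{X}}\ f(y^{k,j})+\langle\nabla f(y^{k,j}),x-y^{k,j}\rangle+\frac{\gamma_{k,j}}{2}\|x-y^{k,j}\|^2+g(x);$$ stop the inner loop at the first $j$ for which, with $z^{k,j}:=(x^{k,j},x^k)$, $$F_\delta(z^{k,j})\le\max_{\max\{0,k-m\}\le i\le k}F_\delta(z^i)-\frac{\alpha\gamma_{k,j}}{2}\|x^{k,j}-x^k\|^2-\frac{\alpha\delta}{2}\|x^k-x^{k-1}\|^2.$$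 With this $j=:j_k$, set $\beta_k:=\beta_{k,j_k}$, $\gamma_k:=\gamma_{k,j_k}$, $x^{k+1}:=x^{k,j_k}$, $y^{k+1}:=y^{k,j_k}$, $z^{k+1}:=z^{k,j_k}$. It is understood that all points $y^{k,j}$ at which $\nabla f$ is evaluated lie in $\mathcal{O}$. KL property: for $\eta\in(0,\infty]$ let $\Upsilon_\eta$ be the family of continuous concave $\varphi:[0,\eta)\to\mathbb{R}_+$ that are continuously differentiable on $(0,\eta)$ with $\varphi'>0$ on $(0,\eta)$ and $\varphi(0)=0$. A proper function $p$ has the KL property at $\overline{u}\in{\rm dom}\,\partial p$ if there exist $\eta\in(0,\infty]$, a neighborhood $\mathcal{U}$ of $\overline{u}$ and $\varphi\in\Upsilon_\eta$ such that $\varphi'(p(u)-p(\overline{u}))\,{\rm dist}(0,\partial p(u))\ge1$ for all $u\in\mathcal{U}$ with $p(\overline{u})<p(u)<p(\overline{u})+\eta$; it has the KL property of exponent $\theta\in[0,1)$ at $\overline{u}$ if $\varphi$ can be chosen as $\varphi(t)=c_0t^{1-\theta}$ for some $c_0>0$. $p$ is a KL function (of exponent $\theta$) if it has the KL property (of exponent $\theta$) at every point of ${\rm dom}\,\partial p$. *)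

(* Defs.v *)
From HB Require Import structures.
From mathcomp Require Import all_boot all_order all_algebra.
From mathcomp Require Import all_classical all_reals all_analysis.

Set Implicit Arguments.
Unset Strict Implicit.
Unset Printing Implicit Defensive.

Import Order.TTheory GRing.Theory Num.Theory.
Import numFieldNormedType.Exports.

Local Open Scope classical_set_scope.
Local Open Scope ring_scope.

Section ExtendedRealFunctions.
Variables (R : realType) (E : normedModType R).
Implicit Type p : E -> \bar R.

Definition proper_fun p : Prop :=
  (forall x, -oo < p x)%E /\ exists x, (p x < +oo)%E.

Definition edom p : set E := [set x | (p x < +oo)%E].

Definition bounded_below p : Prop := exists c : R, forall x, (c%:E <= p x)%E.

End ExtendedRealFunctions.

(* The library norm of E only serves for its topology here; the pairing and the
   Euclidean norm come from ip.  This matters for E = X * X, whose library norm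
   is the max norm. *)
Section Subdifferential.
Variables (R : realType) (E : normedModType R) (ip : E -> E -> R).
Implicit Type p : E -> \bar R.

Definition ipnorm (v : E) : R := Num.sqrt (ip v v).

(* p u >= p x + <v, u - x> + o(|u - x|) as u --> x, at a point where p is
   finite *)
Definition regular_subdiff p (x : E) : set E :=
  [set v | p x \is a fin_num /\
    forall e : R, 0 < e ->
      \forall u \near x,
        (p x + (ip v (u - x) - e * ipnorm (u - x))%:E <= p u)%E].

Definition limiting_subdiff p (x : E) : set E :=
  [set v | p x \is a fin_num /\
    exists u w : nat -> E,
      [/\ u k @[k --> \oo] --> x,
          p (u k) @[k --> \oo] --> p x,
          (forall k, regular_subdiff p (u k) (w k)) &
          w k @[k --> \oo] --> v]].

Definition dom_subdiff p : set E := [set x | limiting_subdiff p x !=set0].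

(* +oo when A is empty *)
Definition dist0 (A : set E) : \bar R :=
  ereal_inf [set (ipnorm v)%:E | v in A].

(* phi is a total function; only its values on [0, eta[ matter. *)
Definition desingularizing (eta : \bar R) (phi : R -> R) : Prop :=
  let D := [set t : R | 0 <= t /\ (t%:E < eta)%E] in
  [/\ (forall t, D t -> 0 <= phi t) /\ phi 0 = 0,
      {within D, continuous phi},
      @convex_function R R^o D (fun t => - phi t) &
      forall t : R, 0 < t -> (t%:E < eta)%E ->
        [/\ derivable phi t 1, {for t, continuous (derive1 phi)}
          & 0 < derive1 phi t]].

Definition KL_inequality p (ubar : E) (eta : \bar R) (phi : R -> R) : Prop :=
  exists2 U : set E, nbhs ubar U &
    forall u, U u -> (p ubar < p u)%E -> (p u < p ubar + eta)%E ->
      (1 <= (derive1 phi (fine (p u - p ubar)))%:E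
             * dist0 (limiting_subdiff p u))%E.

Definition KL_property p (ubar : E) : Prop :=
  exists (eta : \bar R) (phi : R -> R),
    [/\ (0 < eta)%E, desingularizing eta phi & KL_inequality p ubar eta phi].

Definition KL_property_exponent (theta : R) p (ubar : E) : Prop :=
  exists (eta : \bar R) (c0 : R),
    let phi := fun t : R => c0 * t `^ (1 - theta) in
    [/\ (0 < eta)%E, 0 < c0, desingularizing eta phi &
        KL_inequality p ubar eta phi].

Definition KL_function p : Prop :=
  forall ubar, dom_subdiff p ubar -> KL_property p ubar.

Definition KL_function_exponent (theta : R) p : Prop :=
  forall ubar, dom_subdiff p ubar -> KL_property_exponent theta p ubar.

End Subdifferential.

Definition ip_prod (R : realType) (X : normedModType R) (ip : X -> X -> R)
  (z w : X * X) : R := ip z.1 w.1 + ip z.2 w.2.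

Section Smooth.
Variables (R : realType) (X : normedModType R) (ip : X -> X -> R).

Definition is_gradient (f : X -> \bar R) (x v : X) : Prop :=
  let f' : X -> R^o := fun u => fine (f u) in
  differentiable f' x /\ forall h : X, 'd f' x h = ip v h.

(* gradf is only determined on O. *)
Definition continuously_differentiable_on (O : set X) (f : X -> \bar R)
    (gradf : X -> X) : Prop :=
  [/\ (forall x, O x -> f x \is a fin_num),
      (forall x, O x -> is_gradient f x (gradf x)) &
      (forall x, O x -> {for x, continuous gradf})].

Definition strictly_continuous_on (O : set X) (G : X -> X) : Prop :=
  forall x, O x -> exists (L : R) (U : set X), nbhs x U /\ L.-lipschitz_U G.

End Smooth.

Section LineSearchMethod.
Variables (R : realType) (X : normedModType R) (ip : X -> X -> R).

Definition Fdelta (F : X -> \bar R) (delta : R) (z : X * X) : \bar R :=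
  (F z.1 + (delta / 2 * `|z.1 - z.2| ^+ 2)%:E)%E.

(* Throughout, x^{k-1} is written x k.-1: as 0.-1 = 0, this includes the
   convention x^{-1} = x^0. *)
Definition zseq (x : nat -> X) (k : nat) : X * X := (x k, x k.-1).

Definition prox_model (f g : X -> \bar R) (gradf : X -> X) (y : X) (gamma : R)
    (u : X) : \bar R :=
  (f y + (ip (gradf y) (u - y) + gamma / 2 * `|u - y| ^+ 2)%:E + g u)%E.

(* (k - m)%N is truncated, i.e. max {0, k - m} *)
Definition line_search_test (F : X -> \bar R) (m : nat) (delta alpha : R)
    (x : nat -> X) (k : nat) (gamma : R) (u : X) : Prop :=
  (Fdelta F delta (u, x k) <=
     \big[maxe/-oo]_((k - m)%N <= i < k.+1) Fdelta F delta (zseq x i)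
     - (alpha * gamma / 2 * `|u - x k| ^+ 2)%:E
     - (alpha * delta / 2 * `|x k - x k.-1| ^+ 2)%:E)%E.

(* beta0 k, gamma0 k are the initial choices at iteration k, y k j and xt k j
   the inner iterates y^{k,j} and x^{k,j}, and jk k the index at which the inner
   loop stops; the values xt k j with j > jk k are not part of the run. *)
Definition generated_by_method (f g : X -> \bar R) (gradf : X -> X) (O : set X)
    (m : nat) (delta alpha gmin gmax bmax rho nu : R) (x : nat -> X) : Prop :=
  let F u := (f u + g u)%E in
  exists (beta0 gamma0 : nat -> R) (xt : nat -> nat -> X) (jk : nat -> nat),
    let beta k j := beta0 k * nu ^+ j in
    let gamma k j := gamma0 k * rho ^+ j in
    let y k j := x k + beta k j *: (x k - x k.-1) in
    forall k : nat,
      [/\ 0 <= beta0 k <= bmax,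
          gmin <= gamma0 k <= gmax,
          (forall j, (j <= jk k)%N -> O (y k j) /\
             forall u, (prox_model f g gradf (y k j) (gamma k j) (xt k j)
                        <= prox_model f g gradf (y k j) (gamma k j) u)%E),
          (forall j, (j < jk k)%N ->
             ~ line_search_test F m delta alpha x k (gamma k j) (xt k j)) &
          line_search_test F m delta alpha x k (gamma k (jk k)) (xt k (jk k))
          /\ x k.+1 = xt k (jk k)].

Definition stationary (g : X -> \bar R) (gradf : X -> X) (x : X) : Prop :=
  exists2 v, limiting_subdiff ip g x v & 0 = gradf x + v.

End LineSearchMethod.

(* Main.v *)
Require Import Defs.
From HB Require Import structures.
From mathcomp Require Import all_boot all_order all_algebra.
From mathcomp Require Import all_classical all_reals all_analysis.
From mathcomp Require Import zify ring lra.

(** Write z^k = (x^k, x^{k-1}), s_k = |x^k - x^{k-1}|, Phi_k = F_delta(z^k),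
and let M_k be the maximum of Phi over the window [k - m, k]. The idea is that,
although Phi is not monotone, all the quantities of the usual
Kurdyka-Lojasiewicz argument can be measured by the decrease of M over p = 2m +
2 consecutive indices, that is by e_k = sqrt (M_k - M_{k+p}).

It is enough to treat delta > 0. When delta = 0 the function F_delta does not
depend on its second argument, so that a nonempty bounded level set forces X to
be trivial, and then delta can be replaced by 1 without changing anything.

_Every step is bounded by e_k._ The line search test reads
Phi_{k+1} + a (s_{k+1}^2 + s_k^2) <= M_k with a > 0. Hence M is nonincreasing,
with a limit Ms, and the test bounds the two steps that lead to a peak, an
index where the maximum over a window is attained. Conversely, an iteration
with short steps cannot increase Phi by more than a multiple of s_{k+1}^2 +
s_k^2, because the gradient is Lipschitz near the compact level set and the
trial point is at least as good as x^k in the proximal model. So Phi is also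
nearly maximal just before a peak; walking back from a peak at most m times
([backward_from_peak]) one obtains s_{k+m+2}^2 <= C e_k^2 for _all_ large k
([steps_le_window_decrease]). Thus s_k tends to 0 and Phi_k to Ms.

_Step sizes are bounded_ ([stepsize_bounded]). A trial with a large gamma
passes the test: extrapolation contributes a cross term between |x^{k,j} - x^k|
and s_k, which the gap (1 - alpha) delta s_k^2 / 2 absorbs; here delta > 0 is
essential, as is nu rho < 1, which keeps gamma_{k,j} beta_{k,j} below
gamma_max. Therefore F_delta has a subgradient at z^{k+1} of norm at most
b (s_{k+1} + s_k), and every cluster point of z^k is a critical point (c, c)
with value Ms.

_The length is finite._ Concavity puts the KL inequality into the
derivative-free form s - t <= (phi s - phi t) |w|, where s is the excess value,
w a subgradient and 0 <= t <= s ([KL_inequality_integrated]). This form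
survives replacing phi by phi + psi, so a compactness argument yields a single
function h for the whole tail of the sequence ([share_desingularizer_compact]).
Let l be a peak for the index k + p, so that Phi_l = M_{k+p}. With s =
M_{k+p} - Ms and t = M_{k+2p} - Ms the inequality gives e_{k+p}^2 <=
b (h s - h t) (s_l + s_{l-1}), while s_l + s_{l-1} is at most a multiple of e_k
([peak_steps_le]). By the inequality of the means e_{k+p} <= e_k / 2 + B (h s -
h t), which sums up to a finite total ([sqrt_decrease_summable]). KL is applied
at peaks only, where Phi >= Ms; in between Phi may well lie below its limit.

_Rates._ The KL exponent is that of F, not of F_delta, and is used at x^*
alone. Since theta >= 1/2, the power theta of the penalty delta s_l^2 / 2 is
again at most a multiple of s_l, and r_k = M_k - Ms satisfies
r_{k+p}^theta <= C e_k ([peak_value_power_le]). As above, with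
h t = t^{1-theta}, the sum of the e_k beyond n is at most a multiple of
r_n^{1-theta}. Squaring, r_{k+p}^{2 theta} <= C^2 (r_k - r_{k+p}): for theta =
1/2 this is a contraction, and for theta > 1/2 it makes r^{1 - 2 theta} grow at
least linearly. *)

Set Implicit Arguments.
Unset Strict Implicit.
Unset Printing Implicit Defensive.

Import Order.TTheory GRing.Theory Num.Theory.
Import numFieldNormedType.Exports.

Local Open Scope classical_set_scope.
Local Open Scope ring_scope.

(** * Nonmonotone descent *)

Section WindowDescent.
Variables (R : realType) (Phi s M : nat -> R) (m : nat) (a : R).
Hypotheses (a_gt0 : 0 < a) (s_ge0 : forall k, 0 <= s k)
  (Phi_le_M : forall k i, (k - m <= i <= k)%N -> Phi i <= M k)
  (M_attained : forall k, exists2 l, (k - m <= l <= k)%N & Phi l = M k)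
  (descent : forall k, Phi k.+1 + a * (s k.+1 ^+ 2 + s k ^+ 2) <= M k).

Lemma window_max_noninc k l : (k <= l)%N -> M l <= M k.
Proof.
elim: l => [|l ihl]; first by rewrite leqn0 => /eqP ->.
rewrite leq_eqVlt => /orP[/eqP -> //|]; rewrite ltnS => /ihl.
apply: le_trans; have [i /andP[i1 i2] <-] := M_attained l.+1.
have [il|il] := leqP i l; first by apply: Phi_le_M; lia.
have -> : i = l.+1 by lia.
apply: le_trans (descent l); rewrite lerDl mulr_ge0 ?(ltW a_gt0)//.
by rewrite addr_ge0// sqr_ge0.
Qed.

Hypothesis Phi_lb : exists b, forall k, b <= Phi k.

Lemma window_max_cvg :
  exists2 Ms, M k @[k --> \oo] --> Ms & forall k, Ms <= M k.
Proof.
have noninc : nonincreasing_seq M by move=> k l; exact: window_max_noninc.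
have lb : has_lbound (range M).
  have [b hb] := Phi_lb; exists b => _ [k _ <-].
  by have [l _ <-] := M_attained k.
have cM := nonincreasing_is_cvgn noninc lb.
exists (limn M) => // k; exact: nonincreasing_cvgn_ge.
Qed.

Lemma window_max_diff_small p e : 0 < e ->
  \forall k \near \oo, M k - M (k + p)%N < e.
Proof.
move=> e0; have [Ms cM Mge] := window_max_cvg.
have /cvgrPdist_lt /(_ _ e0) := cM; apply: filterS => k.
rewrite distrC ger0_norm ?subr_ge0// => h.
by apply: le_lt_trans h; rewrite lerD2l lerN2.
Qed.

Variables (c eps : R).
Hypotheses (c_ge0 : 0 <= c) (eps_gt0 : 0 < eps)
  (growth : forall k, s k < eps -> s k.+1 < eps ->
     Phi k.+1 <= Phi k + c * (s k.+1 ^+ 2 + s k ^+ 2)).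

(** A lower bound for Phi at l - i gives, through the descent into l - i, a
bound on the two steps around it; these are then short, and the growth
condition turns the bound into one for Phi at l - i - 1. The constant
deteriorates at each of the j moves, which is harmless since j never exceeds
the window length. *)
Lemma backward_from_peak j : (j <= m)%N ->
  exists2 C, 0 <= C & \forall k \near \oo,
    forall l i, (k + m + 2 <= l <= k + 2 * m + 2)%N ->
      Phi l = M (k + 2 * m + 2)%N -> (i <= j)%N ->
      M (k + 2 * m + 2)%N - C * (M k - M (k + 2 * m + 2)%N) <= Phi (l - i)%N.
Proof.
have step C k i : 0 <= C -> (k <= i)%N ->
    M (k + 2 * m + 2)%N - C * (M k - M (k + 2 * m + 2)%N) <= Phi i.+1 ->
    a * (s i.+1 ^+ 2 + s i ^+ 2) <= (1 + C) * (M k - M (k + 2 * m + 2)%N).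
  by move=> C0 ki h; have := descent i; have := window_max_noninc ki; lra.
elim: j => [_|j ihj jm].
  exists 0 => //; apply: nearW => k l i _ <-.
  by rewrite leqn0 => /eqP ->; rewrite subn0; lra.
have [C C0 hC] := ihj (ltnW jm).
have q0 : 0 <= (1 + C) / a by rewrite divr_ge0// ?(ltW a_gt0)// addr_ge0.
exists (C + c * ((1 + C) / a)); first by rewrite addr_ge0// mulr_ge0.
have e'0 : 0 < eps ^+ 2 / ((1 + C) / a).
  by rewrite divr_gt0 ?exprn_gt0 ?divr_gt0 ?ltr_pwDl.
apply: filterS2 hC (window_max_diff_small (2 * m + 2) e'0) => k hC hD l i lk
  Phil.
rewrite addnA in hD.
set D := M k - M (k + 2 * m + 2)%N in hC hD *.
have D0 : 0 <= D by rewrite subr_ge0 window_max_noninc//; lia.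
rewrite leq_eqVlt => /orP[/eqP ->|]; last first.
  rewrite ltnS => ij; apply: le_trans (hC l i lk Phil ij).
  by rewrite lerD2l lerN2 ler_wpM2r// lerDl mulr_ge0.
have := hC l j lk Phil (leqnn j).
have -> : (l - j = (l - j.+1).+1)%N by lia.
move=> hl; have hs := step C k (l - j.+1)%N C0 ltac:(lia) hl.
have hs2 : s (l - j.+1).+1 ^+ 2 + s (l - j.+1)%N ^+ 2 <= (1 + C) / a * D.
  by rewrite mulrAC ler_pdivlMr// mulrC.
have De : (1 + C) / a * D < eps ^+ 2.
  by rewrite mulrC -ltr_pdivlMr// divr_gt0 ?ltr_pwDl.
have small n : n \in [:: (l - j.+1).+1; (l - j.+1)%N] -> s n < eps.
  move=> hn; rewrite -(ltr_pXn2r (ltn0Sn 1)) ?nnegrE ?(ltW eps_gt0)//.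
  apply: le_lt_trans De; apply: le_trans hs2.
  have h1 := sqr_ge0 (s (l - j.+1).+1); have h2 := sqr_ge0 (s (l - j.+1)%N).
  by move: hn; rewrite !inE => /orP[] /eqP ->; lra.
have := growth (small _ (mem_last _ _)) (small _ (mem_head _ _)).
have := ler_wpM2l c_ge0 hs2.
lra.
Qed.

(** The index k + m + 2 is at most m moves before a peak of the window that
ends at k + 2m + 2, hence the constant does not depend on k. *)
Lemma steps_le_window_decrease : exists2 C, 0 <= C & \forall k \near \oo,
  [/\ s (k + m + 2)%N ^+ 2 <= C * (M k - M (k + 2 * m + 2)%N) &
   M (k + 2 * m + 2)%N - C * (M k - M (k + 2 * m + 2)%N) <= Phi (k + m + 2)%N].
Proof.
have [C C0 hC] := backward_from_peak (leqnn m).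
have q0 : 0 <= (1 + C) / a by rewrite divr_ge0// ?(ltW a_gt0)// addr_ge0.
exists (C + (1 + C) / a); first exact: addr_ge0.
apply: filterS hC => k h.
have [l lk Pl] := M_attained (k + 2 * m + 2)%N.
have D0 : 0 <= M k - M (k + 2 * m + 2)%N.
  by rewrite subr_ge0 window_max_noninc//; lia.
have := h l (l - (k + m + 2))%N ltac:(lia) Pl ltac:(lia).
have -> : (l - (l - (k + m + 2)))%N = (k + m + 2)%N by lia.
move=> hi; split; last first.
  apply: le_trans hi; rewrite lerD2l lerN2 ler_wpM2r// lerDl//.
have := descent (k + m + 1)%N.
have -> : ((k + m + 1).+1 = k + m + 2)%N by lia.
have := window_max_noninc (_ : k <= k + m + 1)%N => /(_ ltac:(lia)) hM hd.
have h2 := sqr_ge0 (s (k + m + 1)%N).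
have h3 : a * s (k + m + 2)%N ^+ 2 <= (1 + C) * (M k - M (k + 2 * m + 2)%N).
  have := mulr_ge0 (ltW a_gt0) h2; lra.
apply: (@le_trans _ _ ((1 + C) / a * (M k - M (k + 2 * m + 2)%N))).
  by rewrite mulrAC ler_pdivlMr// mulrC.
by rewrite ler_wpM2r// lerDr.
Qed.

Lemma steps_cvg0 e : 0 < e -> \forall k \near \oo, s k < e.
Proof.
move=> e0; have [C C0 hC] := steps_le_window_decrease.
have e2 : 0 < e ^+ 2 / (C + 1) by rewrite divr_gt0 ?exprn_gt0// ltr_wpDl.
have [N _ hN] : \forall k \near \oo, s (k + m + 2)%N < e.
  apply: filterS2 hC (window_max_diff_small (2 * m + 2) e2) => k [hs _] hd.
  rewrite addnA in hd.
  have D0 : 0 <= M k - M (k + 2 * m + 2)%N.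
    by rewrite subr_ge0 window_max_noninc//; lia.
  rewrite -(ltr_pXn2r (ltn0Sn 1)) ?nnegrE ?(ltW e0)//.
  move: hd; rewrite ltr_pdivlMr ?ltr_wpDl// => hd.
  by apply: le_lt_trans hs _; lra.
exists (N + m + 2)%N => // k /= hk.
have -> : (k = (k - m - 2) + m + 2)%N by lia.
by apply: hN => /=; lia.
Qed.

Lemma values_cvg (Ms : R) : M k @[k --> \oo] --> Ms -> 
  Phi k @[k --> \oo] --> Ms.
Proof.
move=> cM; have [C C0 hC] := steps_le_window_decrease.
have -> : Phi = (fun k => Phi k) by [].
rewrite -(cvg_shiftn (m + 2)).
have cD : M (k + 2 * m + 2)%N - C * (M k - M (k + 2 * m + 2)%N)
    @[k --> \oo] --> Ms.
  have c2 : M (k + 2 * m + 2)%N @[k --> \oo] --> Ms.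
    have -> : (fun k => M (k + 2 * m + 2)%N) = (fun k => M (k + (2 * m + 2))%N).
      by apply/funext => k; rewrite addnA.
    by rewrite (cvg_shiftn (2 * m + 2) M).
  rewrite -[X in _ --> X]subr0 -(mulr0 C) -(subrr Ms).
  by apply: cvgB => //; apply: cvgMr; exact: cvgB.
apply: (squeeze_cvgr _ cD) cM; apply: filterS hC => k [_ hk].
rewrite /= addnA hk/=.
apply: le_trans (window_max_noninc (leq_addr (m + 2) k)).
by rewrite addnA Phi_le_M//; lia.
Qed.

End WindowDescent.

(** * Summation and decay of recursive sequences *)

Section SummationAndRates.
Variables (R : realType).
Implicit Types (e h r : nat -> R) (p n q : nat).

Lemma sum_shift_diff_le h p n q : (forall k, h k.+1 <= h k) ->
  (forall k, 0 <= h k) ->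
  \sum_(n <= k < q) (h k - h (k + p)%N) <= h n *+ p.
Proof.
move=> hS h0; have [qn|nq] := leqP q n.
  by rewrite big_geq// mulrn_wge0.
elim: p => [|p ihp].
  by rewrite big1// => k _; rewrite addn0 subrr.
rewrite (eq_bigr (fun k => (h k - h (k + p)%N) +
    (h (k + p)%N - h (k.+1 + p)%N))).
  rewrite big_split/= mulrSr lerD//.
  rewrite (@telescope_sumr_eq _ n q (fun k => - h (k + p)%N)) ?(ltnW nq)//.
    rewrite opprK addrC; apply: le_trans (_ : h (n + p)%N <= _).
      by rewrite lerBlDr lerDl.
    elim: p {ihp} => [|p ihp]; first by rewrite addn0.
    by apply: le_trans ihp; rewrite addnS.
  by move=> k _; rewrite opprK addrC.
by move=> k _; rewrite addSnnS; lra.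
Qed.

(** Summing the recursion bounds the shifted sum by half of the unshifted one,
and the two differ by p terms only, so the factor 1/2 is absorbed. *)
Lemma sum_le_of_half_recursion e h p n B : 0 <= B ->
  (forall k, 0 <= e k) -> (forall k, h k.+1 <= h k) -> (forall k, 0 <= h k) ->
  (forall k, (n <= k)%N ->
     e (k + p)%N <= 2^-1 * e k + B * (h (k + p)%N - h (k + p + p)%N)) ->
  forall q, \sum_(n <= k < q) e k <=
    2 * \sum_(n <= k < n + p) e k + 2 * B * (h (n + p)%N *+ p).
Proof.
move=> B0 e0 hS h0 rec q.
have tail0 : 0 <= h (n + p)%N *+ p by rewrite mulrn_wge0.
have [qn|nq] := leqP q n.
  by rewrite big_geq// addr_ge0// mulr_ge0// ?sumr_ge0// mulr_ge0.
have split1 : \sum_(n <= k < q) e k <=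
    \sum_(n <= k < n + p) e k + \sum_(n <= k < q) e (k + p)%N.
  have -> : \sum_(n <= k < q) e (k + p)%N = \sum_(n + p <= k < q + p) e k.
    by rewrite big_addn addnK.
  rewrite -big_cat_nat ?leq_addr ?leq_add2r ?(ltnW nq)//=.
  rewrite (@big_cat_nat _ _ _ q n (q + p)) ?leq_addr ?(ltnW nq)//= lerDl.
  exact: sumr_ge0.
have rec' : \sum_(n <= k < q) e (k + p)%N <=
    2^-1 * \sum_(n <= k < q) e k + B * (h (n + p)%N *+ p).
  apply: le_trans (_ : \sum_(n <= k < q) (2^-1 * e k +
     B * (h (k + p)%N - h (k + p + p)%N)) <= _).
    by rewrite !big_nat; apply: ler_sum => k /andP[nk _]; exact: rec.
  rewrite big_split/= -!mulr_sumr lerD2l ler_wpM2l//.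
  apply: (sum_shift_diff_le (h := fun k => h (k + p)%N)) => k /=.
    exact: hS.
  exact: h0.
lra.
Qed.

(** The ratio is the p-th root of the contraction factor; monotonicity fills in
the indices between multiples of p. *)
Lemma geometric_of_periodic_contraction r p n (q0 : R) : (0 < p)%N ->
  0 < q0 -> q0 < 1 -> (forall k, 0 <= r k) -> (forall k, r k.+1 <= r k) ->
  (forall k, (n <= k)%N -> r (k + p)%N <= q0 * r k) ->
  exists A t, [/\ 0 < A, 0 < t, t < 1 &
    forall k, (n <= k)%N -> r k <= A * t ^+ k].
Proof.
move=> p0 q00 q01 r0 rS rec.
pose t := q0 `^ (p%:R^-1).
have t0 : 0 < t by exact: powR_gt0.
have t1 : t < 1.
  have -> : 1 = 1 `^ p%:R^-1 :> R by rewrite powR1.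
  by rewrite gt0_ltr_powR ?invr_gt0 ?ltr0n// nnegrE ltW.
have tp : t ^+ p = q0.
  rewrite -powR_mulrn ?(ltW t0)// -powRrM mulVf ?powRr1 ?(ltW q00)//.
  by rewrite pnatr_eq0 -lt0n.
pose A := (r n + 1) / t ^+ (n + p).
have tn0 : 0 < t ^+ (n + p) by rewrite exprn_gt0.
have A0 : 0 < A by rewrite divr_gt0// ltr_wpDl.
have rnS k l : (k <= l)%N -> r l <= r k.
  elim: l => [|l ih]; first by rewrite leqn0 => /eqP ->.
  rewrite leq_eqVlt => /orP[/eqP -> //|]; rewrite ltnS => /ih.
  exact: le_trans.
exists A, t; split => //; elim/ltn_ind => k ih nk.
(* A was chosen so that the first p terms are bounded by r n. *)
have [kp|kp] := ltnP k (n + p).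
  apply: le_trans (rnS _ _ nk) _; apply: (@le_trans _ _ (A * t ^+ (n + p))).
    by rewrite divfK ?gt_eqF// lerDl.
  rewrite ler_pM2l// ler_wiXn2l// ?(ltW t0) ?(ltW t1)//; exact: ltnW.
have -> : k = (k - p + p)%N by lia.
apply: le_trans (rec _ _) _; first by lia.
rewrite exprD tp mulrA [X in _ <= X]mulrC ler_pM2l//.
by apply: ih; lia.
Qed.

(** The convex function x^{-mu} lies above its tangent at 1. *)
Lemma powRN_ge_tangent (x mu : R) : 0 < x -> 0 <= mu ->
  1 + mu * (1 - x) <= x `^ (- mu).
Proof.
move=> x0 mu0; rewrite /powR gt_eqF//.
apply: le_trans (expR_ge1Dx _); rewrite lerD2l mulNr -mulrN ler_wpM2l//.
have := @le_ln1Dx R (x - 1); rewrite [1 + _]addrC subrK.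
by move=> /(_ ltac:(lra)) => lnx; lra.
Qed.

(** The quantity r^{-mu} grows by at least a constant c every p indices: if r
drops by less than half, the tangent bound for the ratio combined with the
recursion gives it; if r drops by more than half, the tangent bound gives it
outright. *)
Lemma polynomial_of_power_recursion r p n (mu C : R) : (0 < p)%N ->
  0 < mu -> 0 < C -> (forall k, 0 <= r k) -> (forall k, r k.+1 <= r k) ->
  (forall k, (n <= k)%N ->
     r (k + p)%N `^ (1 + mu) <= C * (r k - r (k + p)%N)) ->
  exists2 A, 0 < A & forall k, (2 * (n + p) <= k)%N ->
    r k <= A * k%:R `^ (- mu^-1).
Proof.
move=> p0 mu0 C0 r0 rS rec.
have rnS k l : (k <= l)%N -> r l <= r k.
  elim: l => [|l ih]; first by rewrite leqn0 => /eqP ->.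
  rewrite leq_eqVlt => /orP[/eqP -> //|]; rewrite ltnS => /ih.
  exact: le_trans.
pose c := Num.min (mu * 2^-1 `^ (1 + mu) / C) (mu / 2 * (r n + 1) `^ (- mu)).
have c0 : 0 < c.
  rewrite lt_min !(mulr_gt0, divr_gt0, powR_gt0, invr_gt0)//.
  by rewrite ltr_wpDl.
have incr k : (n <= k)%N -> 0 < r (k + p)%N ->
    r k `^ (- mu) + c <= r (k + p)%N `^ (- mu).
  move=> nk rp.
  have rk : 0 < r k by apply: lt_le_trans rp (rnS _ _ (leq_addr _ _)).
  pose x := r (k + p)%N / r k.
  have x0 : 0 < x by rewrite divr_gt0.
  have rE : r (k + p)%N = r k * x by rewrite mulrCA divff ?mulr1// gt_eqF.
  have y0 : 0 < r k `^ (- mu) by exact: powR_gt0.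
  rewrite rE powRM ?(ltW rk) ?(ltW x0)//.
  have tg := powRN_ge_tangent x0 (ltW mu0).
  have := ler_wpM2l (ltW y0) tg.
  suff : c <= r k `^ (- mu) * (mu * (1 - x)) by lra.
  have [x2|x2] := leP 2^-1 x.
    apply: (@le_trans _ _ (mu * 2^-1 `^ (1 + mu) / C)).
      by rewrite ge_min lexx.
    have := rec k nk; rewrite rE powRM ?(ltW rk) ?(ltW x0)// => h.
    have rk1 : r k `^ (1 + mu) = r k * r k `^ mu.
      rewrite powRD ?powRr1 ?(ltW rk)//.
      by apply/implyP => _; rewrite gt_eqF.
    have h2 : x `^ (1 + mu) * r k `^ mu <= C * (1 - x).
      rewrite -(ler_pM2l rk); apply: le_trans (_ : _ <= C * (r k - r k * x)) _.
        by rewrite (mulrC (x `^ _)) mulrA -rk1.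
      by rewrite le_eqVlt; apply/orP; left; apply/eqP; ring.
    have h3 : 2^-1 `^ (1 + mu) <= x `^ (1 + mu).
      by rewrite ge0_ler_powR ?nnegrE ?invr_ge0 ?(ltW x0)// addr_ge0// ltW.
    have yE : r k `^ (- mu) * r k `^ mu = 1.
      by rewrite powRN mulVf// gt_eqF// powR_gt0.
    have h4 : 2^-1 `^ (1 + mu) * r k `^ mu <= C * (1 - x).
      by apply: le_trans h2; rewrite ler_wpM2r// powR_ge0.
    have := ler_wpM2l (ltW y0) h4; rewrite mulrCA yE mulr1 => h5.
    by rewrite ler_pdivrMr//; have := ler_wpM2l (ltW mu0) h5; lra.
  apply: (@le_trans _ _ (mu / 2 * (r n + 1) `^ (- mu))).
    by rewrite ge_min lexx orbT.
  have yn : (r n + 1) `^ (- mu) <= r k `^ (- mu).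
    rewrite !powRN lef_pV2 ?posrE ?powR_gt0 ?ltr_wpDl//.
    rewrite ge0_ler_powR ?nnegrE ?(ltW mu0) ?(ltW rk) ?addr_ge0//.
    by apply: le_trans (rnS _ _ nk) _; rewrite lerDl.
  apply: (@le_trans _ _ (mu / 2 * r k `^ (- mu))).
    by rewrite ler_wpM2l// divr_ge0// ltW.
  by rewrite mulrC ler_wpM2l ?(ltW y0)// ler_wpM2l ?(ltW mu0)//; lra.
have grow k : (n <= k)%N -> 0 < r k ->
    c / p%:R * (k%:R - (n + p)%:R) <= r k `^ (- mu).
  have cp : 0 < c / p%:R by rewrite divr_gt0// ltr0n.
  elim/ltn_ind: k => k ih nk rk.
  have [kp|kp] := ltnP k (n + p).
    apply: le_trans (powR_ge0 _ _); rewrite mulr_ge0_le0 ?(ltW cp)//.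
    by rewrite subr_le0 ler_nat ltnW.
  have kE : k = (k - p + p)%N by lia.
  have nkp : (n <= k - p)%N by lia.
  rewrite kE; apply: le_trans (incr _ nkp _); last by rewrite -kE.
  have rk' : 0 < r (k - p)%N by apply: lt_le_trans rk (rnS _ _ _); lia.
  have := ih (k - p)%N ltac:(lia) nkp rk'.
  suff -> : c / p%:R * ((k - p + p)%N%:R - (n + p)%:R) =
      c / p%:R * ((k - p)%:R - (n + p)%:R) + c by lra.
  by rewrite natrD; field; rewrite pnatr_eq0 -lt0n.
pose c' := c / p%:R / 2.
have c'0 : 0 < c' by rewrite !divr_gt0// ltr0n.
exists (c' `^ (- mu^-1)); first exact: powR_gt0.
(* Halving the slope absorbs the offset n + p once k is twice as large. *)
move=> k hk; have k0 : 0 < k%:R :> R by rewrite ltr0n; lia.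
have [rk|rk] := leP (r k) 0.
  by apply: le_trans rk _; rewrite mulr_ge0// powR_ge0.
have hg := grow k ltac:(lia) rk.
have hkn : (2 * (n + p))%:R <= k%:R :> R by rewrite ler_nat.
have hy : c' * k%:R <= r k `^ (- mu).
  apply: le_trans hg; rewrite /c' -mulrA ler_wpM2l//.
    by rewrite divr_ge0// ltW.
  by move: hkn; rewrite natrM; lra.
rewrite -(powRM _ (ltW c'0) (ltW k0)).
have -> : r k = (r k `^ (- mu)) `^ (- mu^-1).
  by rewrite -powRrM mulrNN mulfV ?gt_eqF// powRr1// ltW.
have ck0 := mulr_gt0 c'0 k0.
rewrite !(powRN _ mu^-1) lef_pV2 ?posrE ?(powR_gt0 _ ck0) ?powR_gt0//.
by rewrite ge0_ler_powR ?nnegrE ?invr_ge0 ?powR_ge0// ltW.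
Qed.

End SummationAndRates.

(** * Inner products and finite-dimensional compactness *)

Section InnerProduct.
Variables (R : realType) (X : normedModType R) (ip : {dot X for idfun}).
Hypothesis ip_norm : forall x : X, `|x| = Num.sqrt (ip x x).
Implicit Types u v w : X.

Lemma ipC u v : ip u v = ip v u.
Proof. by rewrite hermC expr0 mul1r. Qed.

Lemma ipDl u v w : ip (u + v) w = ip u w + ip v w.
Proof. by rewrite linearDl. Qed.

Lemma ipDr u v w : ip w (u + v) = ip w u + ip w v.
Proof. by rewrite linearDr. Qed.

Lemma ipNl u v : ip (- u) v = - ip u v.
Proof. by rewrite linearNl. Qed.

Lemma ipNr u v : ip u (- v) = - ip u v.
Proof. by rewrite linearNr. Qed.

Lemma ipZl (c : R) u v : ip (c *: u) v = c * ip u v.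
Proof. by rewrite linearZl_LR. Qed.

Lemma ipZr (c : R) u v : ip v (c *: u) = c * ip v u.
Proof. by rewrite ipC ipZl ipC. Qed.

Definition ipE := (ipDl, ipDr, ipNl, ipNr, ipZl, ipZr).

Lemma ip_ge0 u : 0 <= ip u u.
Proof.
have [->|u0] := eqVneq u 0; first by rewrite linear0l.
by rewrite ltW// neq0_dnorm_gt0.
Qed.

Lemma ipxx u : ip u u = `|u| ^+ 2.
Proof. by rewrite ip_norm sqr_sqrtr// ip_ge0. Qed.

Lemma normB_sq u v : `|u - v| ^+ 2 = `|u| ^+ 2 - 2 * ip u v + `|v| ^+ 2.
Proof. by rewrite -!ipxx !ipE (ipC v u); lra. Qed.

Lemma ipnormE u : ipnorm ip u = `|u|.
Proof. by rewrite ip_norm. Qed.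

Lemma cauchy_schwarz u v : `|ip u v| <= `|u| * `|v|.
Proof.
suff h w z : ip w z <= `|w| * `|z|.
  by have := h u v; have := h (- u) v; rewrite ipNl normrN ler_norml; lra.
have [->|w0] := eqVneq w 0; first by rewrite linear0l normr0 mul0r.
have [->|z0] := eqVneq z 0; first by rewrite linear0r normr0 mulr0.
have := ip_ge0 (`|z| *: w - `|w| *: z).
rewrite !ipE !ipxx (ipC z w) => h.
have nw : 0 < `|w| by rewrite normr_gt0.
have nz : 0 < `|z| by rewrite normr_gt0.
have nwz : 0 < `|w| * `|z| by rewrite mulr_gt0.
rewrite -(ler_pM2l nwz); nra.
Qed.

Lemma ip_le_norm u v : ip u v <= `|u| * `|v|.
Proof. exact: le_trans (ler_norm _) (cauchy_schwarz u v). Qed.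

Lemma ip_prod_norm_le (z : X * X) : ipnorm (ip_prod ip) z <= `|z.1| + `|z.2|.
Proof.
rewrite /ipnorm /ip_prod !ipxx -(ger0_norm (_ : 0 <= `|z.1| + `|z.2|))
  ?addr_ge0//.
rewrite -sqrtr_sqr ler_wsqrtr// sqrrD lerD2r lerDl mulrn_wge0// mulr_ge0//.
Qed.

Lemma norm1_le_ip_prod_norm (z : X * X) : `|z.1| <= ipnorm (ip_prod ip) z.
Proof.
rewrite /ipnorm /ip_prod !ipxx -[X in X <= _]ger0_norm// -sqrtr_sqr ler_wsqrtr//.
by rewrite lerDl sqr_ge0.
Qed.

End InnerProduct.

Section FiniteDimension.
Variables (R : realType) (X : normedModType R) (n : nat).
Hypothesis Xfin : Vector.axiom n X.

(** Transport along the linear bijection r from row vectors, where the property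
is known. Continuity of r follows from expanding on the canonical basis, and
the bound from below from the minimum of |r v| on the unit sphere. *)
Lemma findim_bounded_closed_compact (A : set X) :
  bounded_set A -> closed A -> compact A.
Proof.
have [c c_lin [r cK rK]] := Xfin.
have r_lin (a : R) u v : r (a *: u + v) = a *: r u + r v.
  by apply: (can_inj cK); rewrite rK c_lin !rK.
have rD u v : r (u + v) = r u + r v by rewrite -[u]scale1r r_lin !scale1r.
have r0 : r 0 = 0 by apply: (addrI (r 0)); rewrite -rD !addr0.
have rZ (a : R) u : r (a *: u) = a *: r u.
  by rewrite -[a *: u]addr0 r_lin r0 addr0.
have rN u : r (- u) = - r u by apply: (addrI (r u)); rewrite -rD !subrr r0.
pose K := \sum_(i < n) `|r (delta_mx 0 i)|.
have r_bnd v : `|r v| <= K * `|v|.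
  rewrite {1}(row_sum_delta v).
  have -> : r (\sum_(j < n) v 0 j *: delta_mx 0 j) =
      \sum_(j < n) v 0 j *: r (delta_mx 0 j).
    by elim/big_rec2 : _ => [//|i a b _ <-]; rewrite rD rZ.
  apply: le_trans (ler_norm_sum _ _ _) _; rewrite /K mulr_suml.
  apply: ler_sum => i _; rewrite normrZ mulrC ler_wpM2l//.
  rewrite [X in _ <= X]/Num.norm/= mx_normrE.
  exact: (@le_bigmax _ _ _ 0 (fun ij => `|v ij.1 ij.2|) (0, i)).
have r_cont : continuous r.
  move=> v; apply/(@cvgrPdist_le R X _ (nbhs (v : 'rV[R]_n))) => e e0.
  have K0 : 0 <= K by exact: sumr_ge0.
  near=> w; rewrite -rN -rD; apply: le_trans (r_bnd _) _.
  have hw : `|v - w| <= e / (K + 1).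
    by near: w; apply: cvgr_dist_le; rewrite ?divr_gt0// ?ltr_wpDl//.
  apply: le_trans (_ : (K + 1) * `|v - w| <= _).
    by rewrite ler_wpM2r// lerDl.
  by rewrite mulrC -ler_pdivlMr// ltr_wpDl.
pose S := [set v : 'rV[R]_n | `|v| = 1].
have [b b0 r_low] : exists2 b : R, 0 < b & forall v, b * `|v| <= `|r v|.
  have [S0|/set0P/negP/negPn/eqP S0] := pselect (S !=set0); last first.
    exists 1 => // v; have [->|v0] := eqVneq v 0.
      by rewrite r0 !normr0 mulr0.
    have : S (`|v|^-1 *: v).
      by rewrite /S/= normrZ normfV normr_id mulVf// normr_eq0.
    by rewrite S0.
  have cS : compact S.
    apply: bounded_closed_compact.
      by exists 1; split => // M M1 v /= ->; exact: ltW.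
    have -> : S = (fun v : 'rV[R]_n => `|v|) @^-1` [set 1] by [].
    by apply: closed_comp => [v _|]; [exact: norm_continuous|exact: closed_eq].
  have [|v vS hmin] := EVT_min_rV (f := fun v => `|r v|) S0 cS.
    apply: continuous_subspaceT => v.
    by apply: continuous_comp; [exact: r_cont|exact: norm_continuous].
  have vS' : `|v| = 1 by move: vS; rewrite inE.
  exists `|r v|.
    rewrite normr_gt0; apply/eqP => rv0.
    have v0 : v = 0 by apply: (can_inj rK); rewrite rv0 r0.
    by move: vS'; rewrite v0 normr0 => /eqP; rewrite eq_sym oner_eq0.
  move=> w; have [->|w0] := eqVneq w 0; first by rewrite r0 !normr0 mulr0.
  have := hmin (`|w|^-1 *: w); rewrite inE /S/= normrZ normfV normr_id.
  rewrite mulVf ?normr_eq0// => /(_ erefl).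
  by rewrite rZ normrZ normfV normr_id ler_pdivlMl ?normr_gt0// mulrC.
move=> bA clA.
have -> : A = r @` (r @^-1` A).
  by apply/seteqP; split => [x Ax|_ [v Av <-]//]; exists (c x); rewrite /= cK.
apply: continuous_compact; first exact: continuous_subspaceT.
apply: bounded_closed_compact; last first.
  by apply: closed_comp clA => v _; exact: r_cont.
have [M [Mreal hM]] := bA.
exists (M / b); split; first exact: num_real.
move=> N; rewrite ltr_pdivrMr// => /hM hN v /= /hN/= hv.
by rewrite -(ler_pM2l b0) [X in _ <= X]mulrC; apply: le_trans (r_low v) hv.
Unshelve. all: end_near. Qed.

End FiniteDimension.

(** * Subgradients, proximal points and descent *)

Section Subdifferentials.
Variables (R : realType) (X : normedModType R) (ip : {dot X for idfun}).
Hypothesis ip_norm : forall x : X, `|x| = Num.sqrt (ip x x).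

Lemma regular_sub_limiting (E : normedModType R) (ipE : E -> E -> R)
  (p : E -> \bar R) (x : E) :
  regular_subdiff ipE p x `<=` limiting_subdiff ipE p x.
Proof.
move=> v pv; split; first by case: pv.
by exists (fun=> x), (fun=> v); split=> //; exact: cvg_cst.
Qed.

Lemma dist0_le (E : normedModType R) (ipE : E -> E -> R) (A : set E) v :
  A v -> (dist0 ipE A <= (ipnorm ipE v)%:E)%E.
Proof. by move=> Av; apply: ereal_inf_lbound; exists v. Qed.

Lemma is_gradient_near (f : X -> \bar R) (x a : X) (e : R) :
  is_gradient ip f x a -> 0 < e ->
  \forall u \near x,
    `|fine (f u) - fine (f x) - ip a (u - x)| <= e * `|u - x|.
Proof.
move=> [df dE] e0; apply/(nbhs0P _ x).
have /eqaddoP /(_ _ e0) := diff_locally df.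
apply: filterS => h /=; rewrite !fctE/= /shift/= (addrC h x) dE.
by rewrite opprD addrA [x + h - x]addrAC subrr add0r.
Qed.

(** The first-order remainder of f is o(|u - x|) in absolute value, so it
merges with the error term allowed in the subgradient inequality for g. *)
Lemma regular_subdiff_add_smooth (f g : X -> \bar R) (O : set X) (x a v : X) :
  open O -> O x -> (forall u, O u -> f u \is a fin_num) ->
  is_gradient ip f x a -> regular_subdiff ip g x v ->
  regular_subdiff ip (fun u => f u + g u)%E x (a + v).
Proof.
move=> Oop Ox ffin fa [gfin gv].
split; first by rewrite fin_numD ffin.
move=> e e0; have e20 : 0 < e / 2 by rewrite divr_gt0.
apply: filterS3 (open_nbhs_nbhs (conj Oop Ox)) (is_gradient_near fa e20)
  (gv _ e20) => u Ou; rewrite ler_norml ipnormE//.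
rewrite -(fineK (ffin _ Ou)) -(fineK (ffin _ Ox)) -(fineK gfin).
case: (g u) => [r| |] /andP[h1 _]; rewrite -?EFinD ?leey// ?addeNy !lee_fin//.
  by rewrite ipDl// => h2; lra.
Qed.

(** The quadratic penalty lies above its linearization at (x, w), so its
gradient is added to a subgradient of F without any error term. *)
Lemma Fdelta_regular_subdiff (F : X -> \bar R) (delta : R) (x w v : X) :
  0 <= delta -> regular_subdiff ip F x v ->
  regular_subdiff (ip_prod ip) (Fdelta F delta) (x, w)
    (v + delta *: (x - w), - (delta *: (x - w))).
Proof.
move=> d0 [Ffin Fv]; split.
  by rewrite /Fdelta/= fin_numD Ffin.
move=> e e0; have Fve := Fv _ e0.
have : nbhs (x, w) [set z : X * X |
   (F x + (ip v (z.1 - x) - e * ipnorm ip (z.1 - x))%:E <= F z.1)%E].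
  exact: (@cvg_fst _ _ (nbhs x) (nbhs w) _ _ Fve).
apply: filterS => -[u z] /=; rewrite /Fdelta/= -(fineK Ffin).
have hn := @norm1_le_ip_prod_norm _ _ _ ip_norm ((u, z) - (x, w)).
rewrite ipnormE//; case: (F u) => [r| |];
  rewrite -?EFinD ?leey// ?addNye ?leeNy_eq//.
rewrite !lee_fin /ip_prod/= => h.
have hn' := ler_wpM2l (ltW e0) hn; rewrite /= in hn'.
have := mulr_ge0 d0 (ip_ge0 ip (u - z - (x - w))).
rewrite !ipDl// !ipNl// !ipZl//.
rewrite -!(ipxx ip_norm) !ipE//.
move: hn' h; rewrite !ipE// (ipC ip z u) (ipC ip x u)
  (ipC ip x z) (ipC ip w u) (ipC ip w z) (ipC ip w x).
lra.
Qed.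

(** A minimizer of the proximal model lies in the domain of g, since the model
is finite somewhere; there the comparison becomes one between real numbers. *)
Lemma prox_optimality (f g : X -> \bar R) (gradf : X -> X) (y x : X)
    (gamma : R) :
  f y \is a fin_num -> (forall u, -oo < g u)%E -> edom g !=set0 ->
  (forall u, prox_model ip f g gradf y gamma x <=
             prox_model ip f g gradf y gamma u)%E ->
  edom g x /\ forall u, edom g u ->
    fine (g x) + ip (gradf y) (x - y) + gamma / 2 * `|x - y| ^+ 2 <=
    fine (g u) + ip (gradf y) (u - y) + gamma / 2 * `|u - y| ^+ 2.
Proof.
move=> fy gNy [x0 gx0] opt; rewrite /prox_model -(fineK fy) in opt.
have gx : edom g x.
  have := opt x0; move: gx0; rewrite /edom/=.
  have := gNy x0; have := gNy x.
  by case: (g x) => // ; case: (g x0).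
split=> // u gu; have := opt u; move: gx gu; rewrite /edom/=.
have := gNy u; have := gNy x.
case: (g x) => // a _; case: (g u) => // b _ _ _.
by rewrite -!EFinD lee_fin/=; lra.
Qed.

(** Expanding the squares in the optimality of x leaves gamma / 2 |u - x|^2 as
error, which is o(|u - x|). *)
Lemma prox_regular_subdiff (f g : X -> \bar R) (gradf : X -> X) (y x : X)
    (gamma : R) : 0 <= gamma ->
  f y \is a fin_num -> (forall u, -oo < g u)%E -> edom g !=set0 ->
  (forall u, prox_model ip f g gradf y gamma x <=
             prox_model ip f g gradf y gamma u)%E ->
  regular_subdiff ip g x (- gradf y - gamma *: (x - y)).
Proof.
move=> gam0 fy gNy gne opt.
have [gx h] := prox_optimality fy gNy gne opt.
have gxfin : g x \is a fin_num by rewrite fin_numE gt_eqF// lt_eqF.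
split=> // e e0; near=> u; rewrite ipnormE//.
have [gu|gu] := pselect (edom g u); last first.
  suff -> : g u = +oo%E by rewrite leey.
  by apply/eqP; rewrite -leye_eq leNgt; apply/negP.
have gufin : g u \is a fin_num by rewrite fin_numE gt_eqF// lt_eqF.
rewrite -(fineK gxfin) -(fineK gufin) -EFinD lee_fin.
have small : gamma / 2 * `|u - x| <= e.
  have hu : `|u - x| <= e / (gamma / 2 + 1).
    rewrite distrC; near: u; apply: cvgr_dist_le => //.
    by rewrite divr_gt0// ltr_wpDl// divr_ge0.
  apply: le_trans (_ : (gamma / 2 + 1) * `|u - x| <= _).
    by rewrite ler_wpM2r// lerDl.
  by rewrite mulrC -ler_pdivlMr// ltr_wpDl// divr_ge0.
have small2 : gamma / 2 * `|u - x| ^+ 2 <= e * `|u - x|.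
  by rewrite expr2 mulrA ler_wpM2r.
have := h u gu; move: small2.
rewrite -!(ipxx ip_norm) !ipE// (ipC ip y u) (ipC ip y x) (ipC ip x u).
lra.
Unshelve. all: end_near. Qed.

(** The mean value theorem on the segment from x to u, with the gradient along
the segment compared to the gradient at the extrapolated point y. *)
Lemma descent_on_ball (f : X -> \bar R) (gradf : X -> X) (c x u y : X)
    (eps L : R) :
  (forall v, `|v - c| < eps -> is_gradient ip f v (gradf v)) ->
  (forall v w, `|v - c| < eps -> `|w - c| < eps ->
     `|gradf v - gradf w| <= L * `|v - w|) ->
  0 <= L ->
  `|x - c| < eps -> `|u - c| < eps -> `|y - c| < eps ->
  fine (f u) <= fine (f x) + ip (gradf y) (u - x) +
    L * (`|u - x| + `|x - y|) * `|u - x|.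
Proof.
move=> fgrad lip L0 xc uc yc.
pose l (t : R) := x + t *: (u - x).
have lc (t : R) : 0 <= t -> t <= 1 -> `|l t - c| < eps.
  move=> t0 t1; have -> : l t - c = (1 - t) *: (x - c) + t *: (u - c).
    have -> : u - c = (u - x) + (x - c) by rewrite addrA subrK.
    rewrite [in RHS](scalerDr t) addrCA -scalerDl subrK scale1r.
    by rewrite /l addrAC addrC.
  apply: le_lt_trans (ler_normD _ _) _; rewrite !normrZ !ger0_norm ?subr_ge0//.
  by have [->|t1'] := eqVneq t 1; [|have : t < 1 by rewrite lt_neqAle t1']; nra.
pose phi (t : R) : R := fine (f (l t)).
have quot t : (fun h : R => h^-1 *: ((phi \o shift t) (h *: 1) - phi t)) =
    (fun h : R => h^-1 *: (((fun v => fine (f v) : R^o) \o shift (l t))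
       (h *: (u - x)) - fine (f (l t)))).
  apply/funext => h; rewrite /phi /shift/= /l.
  by rewrite [h *: 1]mulr1 scalerDl addrCA addrA.
have dphi (t : R) : 0 <= t -> t <= 1 ->
      is_derive t 1 phi (ip (gradf (l t)) (u - x)).
  move=> t0 t1; have [df dE] := fgrad _ (lc t t0 t1).
  have drv := @diff_derivable _ _ _ _ _ (u - x) df.
  split; first by rewrite /derivable quot.
  by rewrite /derive quot -dE -deriveE.
have [||| t] := @MVT R phi (fun t => ip (gradf (l t)) (u - x)) 0 1.
- exact: ltr01.
- by move=> t; rewrite in_itv/= => /andP[/ltW t0 /ltW t1]; exact: dphi.
- apply: derivable_within_continuous => t; rewrite in_itv/= => /andP[t0 t1].
  by have [] := dphi t t0 t1.
rewrite in_itv/= => /andP[/ltW t0 /ltW t1]; rewrite subr0 mulr1.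
have [l1 l0] : l 1 = u /\ l 0 = x.
  by rewrite /l scale1r scale0r addr0 addrC subrK.
rewrite /phi l1 l0 => fE.
have h1 := ip_le_norm ip_norm (gradf (l t) - gradf y) (u - x).
have h2 : `|gradf (l t) - gradf y| <= L * (`|u - x| + `|x - y|).
  apply: le_trans (lip _ _ (lc t t0 t1) yc) _; rewrite ler_wpM2l//.
  have -> : l t - y = t *: (u - x) + (x - y) by rewrite /l addrA [_ + x]addrC.
  apply: le_trans (ler_normD _ _) _; rewrite lerD2r normrZ ger0_norm//.
  by rewrite ler_piMl.
have := ler_wpM2r (normr_ge0 (u - x)) h2.
by move: h1; rewrite ipDl ipNl; lra.
Qed.

End Subdifferentials.

(** * The Kurdyka-Lojasiewicz inequality without derivatives *)

Section KL.
Variable R : realType.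

(** Chord slopes of a concave function dominate the derivative at the right
end. *)
Lemma desingularizing_tangent (eta : \bar R) (phi : R -> R) (s t : R) :
  desingularizing eta phi -> (s%:E < eta)%E -> 0 <= t -> t <= s ->
  derive1 phi s * (s - t) <= phi s - phi t.
Proof.
move=> [_ _ cvx dphi] seta t0; rewrite le_eqVlt => /orP[/eqP ->|ts].
  by rewrite !subrr mulr0.
have s0 : 0 < s by exact: le_lt_trans ts.
have [drv _ _] := dphi s s0 seta.
rewrite -ler_pdivlMr ?subr_gt0//.
have slope (h : R) : t - s < h -> h < 0 ->
    h^-1 * (phi (h + s) - phi s) <= (phi s - phi t) / (s - t).
  move=> hs h0; pose lam := (- h) / (s - t).
  have st0 : 0 < s - t by rewrite subr_gt0.
  have lam0 : 0 <= lam by rewrite divr_ge0 ?ltW// ?oppr_gt0.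
  have lam1 : lam <= 1 by rewrite ler_pdivrMr// mul1r; lra.
  have lam01 : lam \in `[0, 1] by rewrite in_itv/= lam0.
  have tD : [set t : R | 0 <= t /\ (t%:E < eta)%E] t.
    by split=> //; apply: lt_trans seta; rewrite lte_fin.
  have sD : [set t : R | 0 <= t /\ (t%:E < eta)%E] s by split=> //; exact: ltW.
  have := cvx (Itv01 lam0 lam1) t s; rewrite !inE => /(_ tD sD).
  rewrite !convRE/= /unstable.onem => hc.
  have lamE : lam * (s - t) = - h by rewrite divfK// gt_eqF.
  have hE : lam * t + (1 - lam) * s = h + s by lra.
  have {}hc : - phi (lam * t + (1 - lam) * s) <=
      lam * - phi t + (1 - lam) * - phi s := hc.
  rewrite hE in hc.
  rewrite ler_ndivrMl//.
  have -> : h * ((phi s - phi t) / (s - t)) = - (lam * (phi s - phi t)).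
    by rewrite /lam; field; rewrite gt_eqF.
  by lra.
have cv := cvg_dnbhs_at_left drv.
rewrite derive1E /derive -(cvg_lim _ cv)//; apply: limr_le; first exact: cvgP cv.
near=> h; rewrite /= [h *: 1]mulr1.
by apply: slope; near: h;
  [apply: nbhs_left_gt; rewrite subr_lt0|exact: nbhs_left_lt].
Unshelve. all: end_near. Qed.

Lemma desingularizing_homo (eta : \bar R) (phi : R -> R) (s t : R) :
  desingularizing eta phi -> (s%:E < eta)%E -> 0 <= t -> t <= s ->
  phi t <= phi s.
Proof.
move=> dphi seta t0; rewrite le_eqVlt => /orP[/eqP -> //|ts].
have := desingularizing_tangent dphi seta t0 (ltW ts).
have s0 : 0 < s by exact: le_lt_trans ts.
have [_ _ _ /(_ s s0 seta)[_ _ d0]] := dphi.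
have : 0 <= derive1 phi s * (s - t) by rewrite mulr_ge0 ?subr_ge0 ?ltW.
lra.
Qed.

(** Multiplying the tangent bound by |w| and using phi'(s) |w| >= 1. Unlike the
inequality with phi', the conclusion can be added over several functions phi.
*)
Lemma KL_inequality_integrated (E : normedModType R) (ipE : E -> E -> R)
    (p : E -> \bar R) (ubar : E) (eta : \bar R) (phi : R -> R) :
  desingularizing eta phi -> KL_inequality ipE p ubar eta phi ->
  p ubar \is a fin_num ->
  exists2 U : set E, nbhs ubar U &
    forall u w t, U u -> p u \is a fin_num -> limiting_subdiff ipE p u w ->
      let s := fine (p u) - fine (p ubar) in
      (s%:E < eta)%E -> 0 <= t -> t <= s ->
      s - t <= (phi s - phi t) * ipnorm ipE w.
Proof.
move=> dphi [U nU KLU] pub; exists U => // u w t Uu pu dw s seta t0 ts.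
have w0 : 0 <= ipnorm ipE w by exact: sqrtr_ge0.
have [s0|s0] := leP s 0.
  have -> : t = s by lra.
  by rewrite !subrr mul0r.
have := KLU u Uu.
have sE : fine (p u - p ubar) = s by rewrite fineB.
have lt1 : (p ubar < p u)%E.
  by rewrite -(fineK pu) -(fineK pub) lte_fin -subr_gt0.
have lt2 : (p u < p ubar + eta)%E.
  rewrite -(fineK pu) (_ : fine (p u) = fine (p ubar) + s).
    by rewrite EFinD fineK// lteD2lE.
  by rewrite /s addrC subrK.
rewrite sE => /(_ lt1 lt2) h1.
have [_ _ _ /(_ s s0 seta)[_ _ d0]] := dphi.
have h2 : 1 <= derive1 phi s * ipnorm ipE w.
  rewrite -lee_fin; apply: le_trans h1 _; rewrite EFinM.
  by apply: lee_wpmul2l; [rewrite lee_fin ltW|exact: dist0_le].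
have h3 := desingularizing_tangent dphi seta t0 ts.
have := ler_wpM2r w0 h3.
have : (s - t) <= (s - t) * (derive1 phi s * ipnorm ipE w).
  by rewrite ler_peMr// subr_ge0.
lra.
Qed.

(** Here r k stands for an excess value and d k for the norm of a subgradient.
Only monotonicity and positivity of h are recorded: concavity and
differentiability have done their work once the inequality is integrated. *)
Definition share_desingularizer (r d : nat -> R) (S : set nat) : Prop :=
  exists (eta : R) (h : R -> R),
    [/\ 0 < eta,
        forall t, 0 <= t -> t < eta -> 0 <= h t,
        forall s t, 0 <= t -> t <= s -> s < eta -> h t <= h s &
        forall k t, S k -> r k < eta -> 0 <= t -> t <= r k ->
          r k - t <= (h (r k) - h t) * d k].

Lemma share_desingularizer_sub r d (S T : set nat) : S `<=` T ->
  share_desingularizer r d T -> share_desingularizer r d S.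
Proof.
move=> ST [eta [h [h1 h2 h3 h4]]]; exists eta, h; split=> // k t Sk.
by apply: h4; exact: ST.
Qed.

(** The sum of the two functions works, because each of them is nondecreasing.
*)
Lemma share_desingularizer_setU r d (S T : set nat) : (forall k, 0 <= d k) ->
  share_desingularizer r d S -> share_desingularizer r d T ->
  share_desingularizer r d (S `|` T).
Proof.
move=> d0 [eta1 [h1 [e1 p1 m1 k1]]] [eta2 [h2 [e2 p2 m2 k2]]].
exists (Num.min eta1 eta2), (fun t => h1 t + h2 t); split.
- by rewrite lt_min e1.
- by move=> t t0; rewrite lt_min => /andP[t1 t2]; rewrite addr_ge0 ?p1 ?p2.
- move=> s t t0 ts; rewrite lt_min => /andP[s1 s2].
  by rewrite lerD ?m1 ?m2.
move=> k t ST; rewrite lt_min => /andP[r1 r2] t0 tr.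
have a1 : 0 <= (h1 (r k) - h1 t) * d k by rewrite mulr_ge0// subr_ge0 m1.
have a2 : 0 <= (h2 (r k) - h2 t) * d k by rewrite mulr_ge0// subr_ge0 m2.
by case: ST => [/k1/(_ r1 t0 tr)|/k2/(_ r2 t0 tr)]; lra.
Qed.

Lemma share_desingularizer_set0 r d : share_desingularizer r d set0.
Proof. by exists 1, (fun=> 0); split. Qed.

(** The complements of the index sets that share a function on a tail form a
filter, by the stability under unions. If no tail were good this filter would
be proper, and its image under z would cluster at a point of K, against the
local hypothesis there. It suffices to have that hypothesis at the cluster
points of the sequence itself. *)
Lemma share_desingularizer_compact (T : topologicalType) (K : set T)
    (z : nat -> T) r d :
  (forall k, 0 <= d k) -> compact K -> (forall k, K (z k)) ->
  (forall c, K c -> cluster (z k @[k --> \oo]) c ->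
     exists2 U : set T, nbhs c U &
       exists N, share_desingularizer r d [set k | (N <= k)%N /\ U (z k)]) ->
  exists N, share_desingularizer r d [set k | (N <= k)%N].
Proof.
move=> d0 Kc zK loc; apply: contrapT => nogood.
pose FF : set_system nat := fun S =>
  exists N, share_desingularizer r d [set k | (N <= k)%N /\ ~ S k].
have FFf : Filter FF.
  split.
  - exists 0%N; apply: share_desingularizer_sub (share_desingularizer_set0 r d).
    by move=> k [_]; exact.
  - move=> P Q [N1 h1] [N2 h2]; exists (maxn N1 N2).
    apply: share_desingularizer_sub (share_desingularizer_setU d0 h1 h2).
    move=> k [/=]; rewrite geq_max => /andP[k1 k2] nPQ.
    by have [Pk|nPk] := pselect (P k); [right; split=> // Qk; exact: nPQ|left].
  - move=> P Q PQ [N h]; exists N; apply: share_desingularizer_sub h.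
    by move=> k [kN nQ]; split=> // Pk; exact/nQ/PQ.
have FFp : ProperFilter FF.
  split=> //; move=> [N h]; apply: nogood; exists N.
  by apply: share_desingularizer_sub h => k /= Nk; split.
have FFoo : FF --> \oo.
  move=> A [N _ NA]; exists N.
  apply: share_desingularizer_sub (share_desingularizer_set0 r d).
  by move=> k [Nk nA]; apply: nA; exact: NA.
have [|c [Kc' cc]] := Kc (z @ FF) _.
  by apply: (@filterS _ FF _ setT) => [k _|]; [exact: zK|exact: filterT].
have [|U nU [N gU]] := loc c Kc'.
  by apply: cvg_cluster cc; exact: cvg_app.
have [|w [/= wU Uw]] := cc (~` U) U _ nU; last by [].
by exists N; apply: share_desingularizer_sub gU => k [Nk /contrapT].
Qed.

End KL.

(** * Summability and decay from the integrated inequality *)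

Section SequencesKL.
Variable R : realType.

Lemma le_half_sum_of_sqr_le (u w y : R) : 0 <= u -> 0 <= w -> 0 <= y ->
  u ^+ 2 <= y * w -> u <= 2^-1 * w + 2^-1 * y.
Proof.
move=> u0 w0 y0 h.
rewrite -(ler_pXn2r (ltn0Sn 1)) ?nnegrE//; last first.
  by rewrite addr_ge0// mulr_ge0.
by apply: le_trans h _; have := sqr_ge0 (w - y); lra.
Qed.

(** The concave power t^{1-theta} lies below its tangent at u; multiplied by
u^theta, this is weighted AM-GM and holds at u = 0 too. *)
Lemma powR_tangent (u w theta : R) : 0 < theta -> theta < 1 ->
  0 <= w -> 0 <= u ->
  (1 - theta) * (u - w) <= u `^ theta * (u `^ (1 - theta) - w `^ (1 - theta)).
Proof.
move=> t0 t1 w0 u0.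
have t10 : 0 < 1 - theta by rewrite subr_gt0.
have amgm : u `^ theta * w `^ (1 - theta) <= theta * u + (1 - theta) * w.
  have := @conjugate_powR R (u `^ theta) (w `^ (1 - theta))
    theta^-1 (1 - theta)^-1
    (powR_ge0 _ _) (powR_ge0 _ _).
  rewrite !invr_gt0 !invrK -!powRrM !mulfV ?gt_eqF// !powRr1//.
  move=> /(_ t0 t10); rewrite addrC subrK => /(_ erefl); lra.
have uE : u `^ theta * u `^ (1 - theta) = u.
  by rewrite -powRD ?[theta + _]addrC ?subrK ?powRr1// oner_eq0.
by rewrite [X in _ <= X]mulrBr uE; lra.
Qed.

Section Window.
Variables (Phi s M : nat -> R) (m : nat) (a Ms : R).
Hypotheses (a_gt0 : 0 < a) (s_ge0 : forall k, 0 <= s k)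
  (Phi_le_M : forall k i, (k - m <= i <= k)%N -> Phi i <= M k)
  (M_attained : forall k, exists2 l, (k - m <= l <= k)%N & Phi l = M k)
  (descent : forall k, Phi k.+1 + a * (s k.+1 ^+ 2 + s k ^+ 2) <= M k)
  (M_cvg : M k @[k --> \oo] --> Ms) (Ms_le : forall k, Ms <= M k).

Let p := (2 * m + 2)%N.
Let e k := Num.sqrt (M k - M (k + p)%N).

Let noninc := window_max_noninc a_gt0 Phi_le_M M_attained descent.

Let M_diff_ge0 k : 0 <= M k - M (k + p)%N.
Proof. by rewrite subr_ge0 noninc// leq_addr. Qed.

(** Every index of the window ending at k + p exceeds k by at least m + 2, so
the window maximum that controls the descent into l is at most M k. *)
Lemma peak_steps_le k : exists l, [/\ (k < l)%N, Phi l = M (k + p)%N &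
  s l + s l.-1 <= Num.sqrt (2 / a) * e k].
Proof.
have [l lk Pl] := M_attained (k + p).
exists l; split=> //; first by rewrite /p in lk *; lia.
have l1 : (l.-1.+1 = l)%N by rewrite /p in lk; lia.
have := descent l.-1; rewrite l1 Pl => hd.
have hM : M l.-1 <= M k by apply: noninc; rewrite /p in lk; lia.
have a2 : 0 <= 2 / a by rewrite divr_ge0// ltW.
rewrite /e -sqrtrM// -[X in X <= _]ger0_norm ?addr_ge0//.
rewrite -sqrtr_sqr ler_wsqrtr// [2 / a]mulrC -mulrA mulrC ler_pdivlMr//.
have := sqr_ge0 (s l - s l.-1).
have := mulr_ge0 (ltW a_gt0) (sqr_ge0 (s l - s l.-1)); lra.
Qed.

(** The integrated inequality, applied at the peak of value M (k + p) with t =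
M (k + 2p) - Ms, bounds e (k + p) ^ 2 by a difference that telescopes times e
k; the inequality of the means turns this into a recursion with factor 1/2. *)
Lemma sqrt_decrease_summable (b2 : R) N : 0 <= b2 ->
  share_desingularizer (fun k => Phi k - Ms)
    (fun k => b2 * (s k + s k.-1)) [set k | (N <= k)%N] ->
  exists n T, forall q, \sum_(n <= k < q) e k <= T.
Proof.
move=> b20 [eta [h [eta0 hpos hhomo hKL]]].
have [N1 _ hN1] : \forall k \near \oo, M k - Ms < eta.
  have /cvgrPdist_lt /(_ _ eta0) := M_cvg; apply: filterS => k.
  by rewrite distrC ger0_norm// subr_ge0.
pose n := maxn N N1.
have rk k : (n <= k)%N -> 0 <= M k - Ms /\ M k - Ms < eta.
  move=> nk; rewrite subr_ge0 Ms_le; split=> //.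
  by apply: hN1 => /=; rewrite (leq_trans _ nk)// leq_maxr.
(* Freezing the indices below n makes hh nonnegative and nonincreasing
   everywhere. *)
pose hh k := h (M (maxn n k) - Ms).
have hhE k : (n <= k)%N -> hh k = h (M k - Ms) by rewrite /hh => /maxn_idPr ->.
have hS k : hh k.+1 <= hh k.
  have [_ r2] := rk _ (leq_maxl n k); have [r3 _] := rk _ (leq_maxl n k.+1).
  apply: hhomo => //; rewrite lerD2r noninc// geq_max leq_maxl/=.
  by rewrite (leq_trans (leqnSn k))// leq_maxr.
have h0 k : 0 <= hh k by have [r1 r2] := rk _ (leq_maxl n k); exact: hpos.
pose B := 2^-1 * (b2 * Num.sqrt (2 / a)).
have B0 : 0 <= B by rewrite !mulr_ge0// sqrtr_ge0.
have rec k : (n <= k)%N ->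
    e (k + p)%N <= 2^-1 * e k + B * (hh (k + p)%N - hh (k + p + p)%N).
  move=> nk; rewrite /B -mulrA.
  have nkp : (n <= k + p)%N by rewrite (leq_trans nk)// leq_addr.
  have nkpp : (n <= k + p + p)%N by rewrite (leq_trans nkp)// leq_addr.
  have [r1 r2] := rk _ nkp; have [r3 r4] := rk _ nkpp.
  have dh : 0 <= hh (k + p)%N - hh (k + p + p)%N.
    by rewrite subr_ge0 !hhE// hhomo// lerD2r noninc// leq_addr.
  have q0 : 0 <= Num.sqrt (2 / a) by exact: sqrtr_ge0.
  apply: le_half_sum_of_sqr_le; rewrite ?sqrtr_ge0// ?mulr_ge0//.
  rewrite sqr_sqrtr//.
  have [l [kl Pl hl]] := peak_steps_le k.
  have Nl : (N <= l)%N.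
    by apply: leq_trans (ltnW kl); apply: leq_trans nk; exact: leq_maxl.
  have := hKL l (M (k + p + p)%N - Ms) Nl; rewrite /= Pl => /(_ r2 r3).
  rewrite lerD2r noninc ?leq_addr// => /(_ isT).
  rewrite !hhE// opprB addrA subrK => hk; apply: le_trans hk _.
  rewrite !hhE// in dh.
  apply: le_trans (ler_wpM2l dh (ler_wpM2l b20 hl)) _.
  by rewrite le_eqVlt; apply/orP; left; apply/eqP; ring.
exists n; eexists => q.
exact: (sum_le_of_half_recursion B0 (fun k => sqrtr_ge0 _) hS h0 rec).
Qed.

End Window.

Section Rates.
Variables (r : nat -> R) (p N : nat) (theta C : R).
Hypotheses (p_gt0 : (0 < p)%N) (theta_ge : 2^-1 <= theta) (theta_lt1 : theta < 1)
  (r_ge0 : forall k, 0 <= r k) (r_noninc : forall k, r k.+1 <= r k)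
  (C_gt0 : 0 < C).
Let e k := Num.sqrt (r k - r (k + p)%N).
Hypothesis rec : forall k, (N <= k)%N -> r (k + p)%N `^ theta <= C * e k.

Let r_homo k l : (k <= l)%N -> r l <= r k.
Proof.
elim: l => [|l ih]; first by rewrite leqn0 => /eqP ->.
rewrite leq_eqVlt => /orP[/eqP -> //|]; rewrite ltnS => /ih.
exact: le_trans.
Qed.

Let r_diff k : 0 <= r k - r (k + p)%N.
Proof. by rewrite subr_ge0 r_homo// leq_addr. Qed.

Let theta_gt0 : 0 < theta.
Proof. by apply: lt_le_trans theta_ge; rewrite invr_gt0. Qed.

(** The same recursion with t^{1-theta} in the role of the desingularizing
function. The p initial terms are at most sqrt (r n), hence at most r n ^ (1 -
theta) as r n <= 1 and theta >= 1/2. *)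
Lemma tail_le_value_power : exists2 C1, 0 <= C1 & forall n q, (N <= n)%N ->
  r n <= 1 -> \sum_(n <= k < q) e k <= C1 * r n `^ (1 - theta).
Proof.
have t10 : 0 < 1 - theta by rewrite subr_gt0.
pose B := 2^-1 * (C / (1 - theta)).
have B0 : 0 <= B by rewrite mulr_ge0// divr_ge0// ltW.
have B2 : 0 <= 2 * B by rewrite mulr_ge0.
exists (2 * p%:R + 2 * B * p%:R); first by apply: addr_ge0; apply: mulr_ge0.
move=> n q Nn rn1.
pose h k := r k `^ (1 - theta).
have h_homo k l : (k <= l)%N -> h l <= h k.
  by move=> kl; rewrite ge0_ler_powR ?nnegrE ?(ltW t10)// r_homo.
have recH k : (n <= k)%N ->
    e (k + p)%N <= 2^-1 * e k + B * (h (k + p)%N - h (k + p + p)%N).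
  move=> nk; rewrite /B -mulrA.
  have dh : 0 <= h (k + p)%N - h (k + p + p)%N.
    by rewrite subr_ge0 h_homo// leq_addr.
  have Ct0 : 0 <= C / (1 - theta) by rewrite divr_ge0// ltW.
  apply: le_half_sum_of_sqr_le; rewrite ?sqrtr_ge0//; first exact: mulr_ge0.
  rewrite sqr_sqrtr//.
  have h1 := powR_tangent theta_gt0 theta_lt1 (r_ge0 (k + p + p)) (r_ge0 (k + p)).
  have h2 := ler_wpM2r dh (rec (leq_trans Nn nk)).
  rewrite -(ler_pM2l t10); apply: le_trans h1 _; apply: le_trans h2 _.
  rewrite le_eqVlt; apply/orP; left; apply/eqP.
  by field; rewrite gt_eqF.
have := sum_le_of_half_recursion B0 (fun k => sqrtr_ge0 _)
  (fun k => h_homo _ _ (leqnSn k)) (fun k => powR_ge0 _ _) recH q.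
move=> hsum; apply: le_trans hsum _; rewrite [X in _ <= X]mulrDl lerD//.
  rewrite -mulrA ler_wpM2l//.
  have -> : p%:R * r n `^ (1 - theta) = \sum_(n <= k < n + p) r n `^ (1 - theta).
    by rewrite sumr_const_nat addKn mulr_natl.
  rewrite !big_nat; apply: ler_sum => k /andP[nk _].
  apply: le_trans (_ : Num.sqrt (r n) <= _).
    rewrite ler_wsqrtr// lerBlDr; apply: le_trans (r_homo nk) _.
    by rewrite lerDl.
  have [rn0|rn0] := eqVneq (r n) 0.
    by rewrite rn0 sqrtr0 powR_ge0.
  rewrite -powR12_sqrt// ger_powR//.
    by rewrite lt0r rn0 r_ge0 rn1.
  by move: theta_ge; lra.
rewrite -[h (n + p)%N *+ p]mulr_natl [X in X <= _]mulrA.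
apply: ler_wpM2l; first exact: mulr_ge0.
by apply: h_homo; rewrite leq_addr.
Qed.

Lemma values_geometric : theta = 2^-1 -> exists A t,
  [/\ 0 < A, 0 < t, t < 1 & forall k, (N <= k)%N -> r k <= A * t ^+ k].
Proof.
move=> tE.
apply: (@geometric_of_periodic_contraction R r p N (C ^+ 2 / (1 + C ^+ 2))) => //.
- by rewrite divr_gt0 ?addr_gt0 ?exprn_gt0.
- by rewrite ltr_pdivrMr ?addr_gt0 ?exprn_gt0// mul1r ltrDr.
move=> k Nk; have := rec Nk; rewrite tE powR12_sqrt// => h.
have h2 : r (k + p)%N <= C ^+ 2 * (r k - r (k + p)%N).
  have Ce0 : 0 <= C * e k by rewrite mulr_ge0 ?sqrtr_ge0// ltW.
  have := h; rewrite -(ler_pXn2r (ltn0Sn 1)) ?nnegrE ?sqrtr_ge0//.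
  by rewrite exprMn !sqr_sqrtr.
rewrite mulrAC ler_pdivlMr ?addr_gt0 ?exprn_gt0//; lra.
Qed.

Lemma values_polynomial : 2^-1 < theta -> exists2 A, 0 < A &
  forall k, (2 * (N + p) <= k)%N -> r k <= A * k%:R `^ (- (2 * theta - 1)^-1).
Proof.
move=> t2.
apply: (@polynomial_of_power_recursion R r p N _ (C ^+ 2)) => //.
- by move: t2; lra.
- by rewrite exprn_gt0.
move=> k Nk; rewrite addrC subrK.
have -> : 2 * theta = theta * 2%:R by rewrite mulrC.
have Ce0 : 0 <= C * e k by rewrite mulr_ge0 ?sqrtr_ge0// ltW.
rewrite powRrM powR_mulrn ?powR_ge0//.
have := rec Nk; rewrite -(ler_pXn2r (ltn0Sn 1)) ?nnegrE ?powR_ge0//.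
by rewrite exprMn sqr_sqrtr.
Qed.

End Rates.
End SequencesKL.

(** * Convergence of sequences of finite length *)

Lemma cluster_subsequence (R : realType) (T : pseudoMetricType R)
    (z : nat -> T) (c : T) (n0 : nat) : cluster (z k @[k --> \oo]) c ->
  exists2 sig : nat -> nat, (forall i, (n0 + i < sig i)%N) &
    z (sig i) @[i --> \oo] --> c.
Proof.
move=> cc.
have : forall i, exists k, (n0 + i < k)%N /\ ball c i.+1%:R^-1 (z k).
  move=> i.
  have nz : (z k @[k --> \oo]) (z @` [set k | (n0 + i < k)%N]).
    by exists (n0 + i).+1 => // k /= ki; exists k.
  have nc : nbhs c (ball c i.+1%:R^-1).
    by apply: nbhsx_ballx; rewrite invr_gt0 ltr0n.
  have [u [[k ki <-] bk]] := cc _ _ nz nc.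
  by exists k.
move=> /choice[sig hsig]; exists sig; first by move=> i; case: (hsig i).
apply/cvg_ballP => e e0; near=> i.
apply: (@le_ball _ _ _ i.+1%:R^-1); last by case: (hsig i).
by apply: ltW; near: i; exact: near_infty_natSinv_lt (PosNum e0).
Unshelve. all: end_near. Qed.

Lemma subseq_cvgoo (sig : nat -> nat) n0 : (forall i, (n0 + i < sig i)%N) ->
  sig i @[i --> \oo] --> \oo.
Proof.
move=> h A [k _ kA]; exists k => // i /= ki; apply: kA => /=.
by have := h i; lia.
Qed.

Section SummableSteps.
Variables (R : realType) (X : normedModType R) (x : nat -> X).

Lemma dist_le_sum_steps k l : (k <= l)%N ->
  `|x k - x l| <= \sum_(k <= j < l) `|x j.+1 - x j|.
Proof.
move=> kl; rewrite distrC -(telescope_sumr x kl).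
exact: ler_norm_sum.
Qed.

(** A cluster point provides the limit, and the length of the tail controls the
distance to it. *)
Lemma summable_steps_cvg (K : set X) n T : compact K -> (forall k, K (x k)) ->
  (forall q, \sum_(n <= j < q) `|x j.+1 - x j| <= T) ->
  exists c : X, x k @[k --> \oo] --> c.
Proof.
move=> Kc xK bT.
have nK : (x k @[k --> \oo]) K by exists 0%N => // k _; exact: xK.
have [c [_ cc]] := Kc (x k @[k --> \oo]) _ nK.
exists c; apply/cvgrPdist_le => e e0.
have e20 : 0 < e / 2 by rewrite divr_gt0.
pose P q := \sum_(n <= j < q) `|x j.+1 - x j|.
have PS k l : (n <= k)%N -> (k <= l)%N -> 
    P l = P k + \sum_(k <= j < l) `|x j.+1 - x j|.
  by move=> nk kl; rewrite /P (@big_cat_nat _ _ _ k n l).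
have Pnd : nondecreasing_seq P.
  move=> k l kl; have [nk|kn] := leqP n k.
    by rewrite (PS _ _ nk kl) lerDl sumr_ge0.
  by rewrite {1}/P big_geq ?(ltnW kn)// sumr_ge0.
have Pub : has_ubound (range P) by exists T => _ [q _ <-]; exact: bT.
have Pcv := nondecreasing_is_cvgn Pnd Pub.
have Ple k : P k <= limn P by exact: nondecreasing_cvgn_le.
have /cvgrPdist_le /(_ _ e20) [N1 _ hN1] := Pcv.
have [sig sigN xc] := cluster_subsequence (maxn n N1) cc.
have /cvgrPdist_le /(_ _ e20) [N2 _ hN2] := xc.
pose k0 := sig N2.
have hk0 : `|c - x k0| <= e / 2 by apply: hN2 => /=.
have nk0 : (n <= k0)%N.
  by have := sigN N2; have := leq_maxl n N1; rewrite -/k0; lia.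
have Nk0 : (N1 <= k0)%N.
  by have := sigN N2; have := leq_maxr n N1; rewrite -/k0; lia.
exists k0 => // k /= kk.
rewrite -(subrK (x k0) c) -addrA [e]splitr.
apply: le_trans (ler_normD _ _) _; rewrite lerD//.
apply: le_trans (dist_le_sum_steps kk) _.
have := hN1 k0 Nk0; have := Ple k; rewrite (PS k0 k)// => h1 h2.
have : limn P - P k0 <= e / 2 by apply: le_trans h2; exact: ler_norm.
lra.
Qed.

Lemma dist_limit_le_series c k : x q @[q --> \oo] --> c ->
  ((`|x k - c|)%:E <= \sum_(k <= j <oo) (`|x j.+1 - x j|)%:E)%E.
Proof.
move=> xc; set S := (X in (_ <= X)%E).
have part q : (k <= q)%N -> ((`|x k - x q|)%:E <= S)%E.
  move=> kq; apply: (@le_trans _ _ (\sum_(k <= j < q) `|x j.+1 - x j|)%:E).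
    by rewrite lee_fin dist_le_sum_steps.
  rewrite -sumEFin; apply: nneseries_lim_ge => j _ _.
  by rewrite lee_fin.
have := part k (leqnn k).
clearbody S; case: S part => [r| |] part; rewrite ?leey//.
move=> _; rewrite lee_fin.
have h : `|x k - x q| @[q --> \oo] --> `|x k - c|.
  by apply: cvg_norm; apply: cvgB => //; exact: cvg_cst.
apply: (ler_cvg_to h (cvg_cst r)); by exists k.
Qed.

Lemma series_le k (B : R) :
  (forall q, \sum_(k <= j < q) `|x j.+1 - x j| <= B) ->
  (\sum_(k <= j <oo) (`|x j.+1 - x j|)%:E <= B%:E)%E.
Proof.
move=> hB; apply: lime_le.
  by apply: is_cvg_nneseries => j _ _; rewrite lee_fin.
by apply: nearW => q; rewrite sumEFin lee_fin.
Qed.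

End SummableSteps.

(** * From estimates on the iterates to convergence and rates *)

Section Convergence.
Variables (R : realType) (X : normedModType R) (ip : {dot X for idfun})
  (ip_norm : forall x : X, `|x| = Num.sqrt (ip x x))
  (f g : X -> \bar R) (O : set X) (gradf : X -> X)
  (O_open : open O) (dom_g_O : edom g `<=` O)
  (f_C1 : continuously_differentiable_on ip O f gradf)
  (g_gtNy : forall u, (-oo < g u)%E)
  (F_lsc : lower_semicontinuous (fun u => f u + g u)%E)
  (delta : R) (delta_ge0 : 0 <= delta)
  (x : nat -> X) (x_dom : forall k, edom g (x k))
  (K : set X) (K_compact : compact K) (K_dom : K `<=` edom g)
  (x_K : forall k, K (x k)).

Let F u := (f u + g u)%E.
Let Fr u := fine (f u) + fine (g u).
Let s k := `|x k - x k.-1|.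
Let Phi k := Fr (x k) + delta / 2 * s k ^+ 2.

Variables (Ms : R) (N : nat) (b : R) (v : nat -> X).
Hypotheses (Phi_cvg : Phi k @[k --> \oo] --> Ms)
  (s_cvg0 : s k @[k --> \oo] --> 0)
  (b_ge0 : 0 <= b)
  (v_sub : forall k, (N <= k)%N -> regular_subdiff ip g (x k.+1) (v k))
  (v_small : forall k, (N <= k)%N ->
     `|gradf (x k.+1) + v k| <= b * (s k.+1 + s k))
  (g_compare : forall k c, (N <= k)%N -> edom g c ->
     fine (g (x k.+1)) <= fine (g c) + b * `|c - x k.+1| +
       b * (`|c - x k.+1| + (s k.+1 + s k)) ^+ 2).

Let f_fin' u : edom g u -> f u \is a fin_num.
Proof. by move=> /dom_g_O; case: f_C1 => h _ _; exact: h. Qed.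

Let g_fin' u : edom g u -> g u \is a fin_num.
Proof. by move=> gu; rewrite fin_numE gt_eqF// lt_eqF. Qed.

Let FE' u : edom g u -> F u = (Fr u)%:E.
Proof. by move=> gu; rewrite EFinD !fineK ?f_fin' ?g_fin'. Qed.

Let s_pos k : 0 <= s k. Proof. exact: normr_ge0. Qed.

Lemma Fr_cvg : Fr (x k) @[k --> \oo] --> Ms.
Proof.
have -> : (fun k => Fr (x k)) = (fun k => Phi k - delta / 2 * s k ^+ 2).
  by apply/funext => k; rewrite /Phi addrK.
have -> : Ms = Ms - delta / 2 * 0 ^+ 2 by rewrite expr0n/= mulr0 subr0.
by apply: cvgB => //; apply: cvgMr; exact: (cvgM s_cvg0 s_cvg0).
Qed.

Section LimitPoint.
Variables (sig : nat -> nat) (c : X).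
Hypotheses (sigN : forall i, (N + i < sig i)%N)
  (xc : x (sig i) @[i --> \oo] --> c).

Let sigoo := subseq_cvgoo sigN.

Lemma limit_point_K : K c.
Proof.
have Kcl : closed K by apply: compact_closed => //; exact: norm_hausdorff.
by apply: (closed_cvg K Kcl _ c xc); apply: nearW => i; exact: x_K.
Qed.

Let gc := K_dom limit_point_K.

Lemma f_limit_point : fine (f (x (sig i))) @[i --> \oo] --> fine (f c).
Proof.
have [_ fgrad _] := f_C1; have [df _] := fgrad _ (dom_g_O gc).
exact: (cvg_comp _ (fun u => fine (f u)) xc (differentiable_continuous df)).
Qed.

Lemma gradf_limit_point : gradf (x (sig i)) @[i --> \oo] --> gradf c.
Proof.
have [_ _ gcont] := f_C1.
exact: (cvg_comp _ gradf xc (gcont _ (dom_g_O gc))).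
Qed.

Let s_sig : s (sig i) @[i --> \oo] --> 0.
Proof. exact: (cvg_comp _ s sigoo s_cvg0). Qed.

Let s_sig1 : s (sig i).-1 @[i --> \oo] --> 0.
Proof.
apply: (cvg_comp (fun i => (sig i).-1) s _ s_cvg0).
move=> A [k _ kA]; exists k => // i /= ki; apply: kA => /=.
by have := sigN i; lia.
Qed.

Let x_dist : `|c - x (sig i)| @[i --> \oo] --> 0.
Proof.
rewrite -(normr0 X) -(subrr c); apply: cvg_norm; apply: cvgB => //.
exact: cvg_cst.
Qed.

(** Values could drop in the limit, as g is merely lower semicontinuous.
Comparing the proximal point x (sig i) with c in the proximal model excludes
this. *)
Lemma Fr_limit_point : Fr c = Ms.
Proof.
have Frs : Fr (x (sig i)) @[i --> \oo] --> Ms.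
  exact: (cvg_comp _ (Fr \o x) sigoo Fr_cvg).
apply/eqP; rewrite eq_le; apply/andP; split.
  apply/ler_addgt0Pr => e e0; rewrite -lerBlDr.
  have [|V nV hV] := F_lsc (x := c) (a := Fr c - e).
    by rewrite -[X in (_ < X)%E]/(F c) FE'// lte_fin ltrBlDr ltrDl.
  apply: (ler_cvg_to (cvg_cst (Fr c - e)) Frs).
  have nx : \forall i \near \oo, V (x (sig i)) .
    by apply: xc.
  by apply: filterS nx => i /hV;
    rewrite -[X in (_ < X)%E]/(F _) FE'// lte_fin => /ltW.
have bnd : fine (f (x (sig i))) + (fine (g c) + b * `|c - x (sig i)| +
    b * (`|c - x (sig i)| + (s (sig i) + s (sig i).-1)) ^+ 2) @[i --> \oo] -->
    fine (f c) + (fine (g c) + b * 0 + b * (0 + (0 + 0)) ^+ 2).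
  apply: cvgD; first exact: f_limit_point.
  apply: cvgD; first by apply: cvgD; [exact: cvg_cst|exact: cvgMr].
  have cD : `|c - x (sig i)| + (s (sig i) + s (sig i).-1) @[i --> \oo] -->
      0 + (0 + 0) by apply: cvgD; [exact: x_dist|exact: cvgD].
  by apply: cvgMr; exact: (cvgM cD cD).
rewrite !addr0 expr0n/= !mulr0 !addr0 in bnd.
apply: (ler_cvg_to Frs bnd); apply: nearW => i.
rewrite /Fr lerD2l; have := @g_compare (sig i).-1 c.
have -> : ((sig i).-1.+1 = sig i)%N by have := sigN i; lia.
by apply => //; have := sigN i; lia.
Qed.

Lemma g_limit_point : g (x (sig i)) @[i --> \oo] --> g c.
Proof.
have Frs : Fr (x (sig i)) @[i --> \oo] --> Ms.
  exact: (cvg_comp _ (Fr \o x) sigoo Fr_cvg).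
have -> : (fun i => g (x (sig i))) =
    (fun i => (Fr (x (sig i)) - fine (f (x (sig i))))%:E).
  by apply/funext => i; rewrite /Fr addrC addKr fineK// g_fin'.
have -> : g c = (Ms - fine (f c))%:E.
  by rewrite -Fr_limit_point /Fr addrC addKr fineK// g_fin'.
by apply: cvg_EFin; [exact: nearW|]; apply: cvgB => //; exact: f_limit_point.
Qed.

Let w i := gradf (x (sig i)) + v (sig i).-1.

Let sigE i : ((sig i).-1.+1 = sig i)%N.
Proof. by have := sigN i; lia. Qed.

Let sigN1 i : (N <= (sig i).-1)%N.
Proof. by have := sigN i; lia. Qed.

Lemma subgradient_cvg0 : w i @[i --> \oo] --> 0.
Proof.
apply/norm_cvg0P.
apply: (@squeeze_cvgr _ _ _ _ (fun=> 0) (fun i => b * (s (sig i) + s (sig i).-1))).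
- apply: nearW => i; rewrite normr_ge0/=.
  by have := v_small (sigN1 i); rewrite sigE.
- exact: cvg_cst.
- have h : b * (s (sig i) + s (sig i).-1) @[i --> \oo] --> b * (0 + 0).
    by apply: cvgMr; exact: cvgD.
  by rewrite addr0 mulr0 in h.
Qed.

Lemma limit_point_stationary : stationary ip g gradf c.
Proof.
exists (- gradf c); last by rewrite subrr.
split; first exact: g_fin'.
exists (x \o sig), (fun i => v (sig i).-1); split.
- exact: xc.
- exact: g_limit_point.
- by move=> i /=; have := v_sub (sigN1 i); rewrite sigE.
have -> : (fun i => v (sig i).-1) = (fun i => w i - gradf (x (sig i))).
  by apply/funext => i; rewrite /w addrC addKr.
rewrite -[- gradf c]add0r; apply: cvgB.
- exact: subgradient_cvg0.
- exact: gradf_limit_point.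
Qed.

Lemma F_subgradient k : (N <= k)%N ->
  regular_subdiff ip F (x k.+1) (gradf (x k.+1) + v k).
Proof.
move=> Nk; have [ffin fgrad _] := f_C1.
apply: (regular_subdiff_add_smooth ip_norm O_open) => //.
- exact/dom_g_O.
- by apply: fgrad; exact/dom_g_O.
- exact: v_sub.
Qed.

Let F_cvg : F (x (sig i)) @[i --> \oo] --> F c.
Proof.
rewrite (FE' gc) Fr_limit_point; under eq_fun do rewrite FE'//.
apply: cvg_EFin; first exact: nearW.
exact: (cvg_comp _ (Fr \o x) sigoo Fr_cvg).
Qed.

(** The limit has to be critical for F, and not only stationary, for the KL
property of F to be applicable there. *)
Lemma limit_point_critical : limiting_subdiff ip F c 0.
Proof.
split; first by rewrite FE'.
exists (x \o sig), w; split; [exact: xc|exact: F_cvg| |exact: subgradient_cvg0].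
by move=> i /=; rewrite /w; have := F_subgradient (sigN1 i); rewrite sigE.
Qed.

End LimitPoint.

Let b2 := b + 2 * delta.

Lemma Fdelta_subgradient k : (N <= k)%N -> exists2 w : X * X,
  limiting_subdiff (ip_prod ip) (Fdelta F delta) (zseq x k.+1) w &
  ipnorm (ip_prod ip) w <= b2 * (s k.+1 + s k).
Proof.
move=> Nk.
exists (gradf (x k.+1) + v k + delta *: (x k.+1 - x k),
        - (delta *: (x k.+1 - x k))).
  apply: regular_sub_limiting; apply: (Fdelta_regular_subdiff ip_norm) => //.
  exact: F_subgradient.
apply: le_trans (ip_prod_norm_le ip_norm _) _ => /=.
rewrite normrN normrZ ger0_norm//.
have h1 := v_small Nk.
have h2 : `|gradf (x k.+1) + v k + delta *: (x k.+1 - x k)| <=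
    `|gradf (x k.+1) + v k| + delta * s k.+1.
  by apply: le_trans (ler_normD _ _) _; rewrite normrZ ger0_norm.
have h3 : 0 <= delta * s k by rewrite mulr_ge0// s_pos.
have sE : `|x k.+1 - x k| = s k.+1 by [].
by rewrite sE /b2; move: h1 h2 h3; lra.
Qed.

Lemma FdeltaE' k : Fdelta F delta (zseq x k) = (Phi k)%:E.
Proof. by rewrite /Fdelta/= FE'. Qed.

Hypothesis Fdelta_KL : KL_function (ip_prod ip) (Fdelta F delta).

(** The second component of z^k is a previous iterate, with the same limit as
steps vanish; the gradient of the penalty vanishes along with the steps. *)
Lemma limit_point_Fdelta_critical (sig : nat -> nat) c :
  (forall i, (N + i < sig i)%N) -> x (sig i) @[i --> \oo] --> c ->
  x (sig i).-1 @[i --> \oo] --> c ->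
  Fdelta F delta (c, c) = Ms%:E /\
  limiting_subdiff (ip_prod ip) (Fdelta F delta) (c, c) (0, 0).
Proof.
move=> sigN xc xc1.
have gc : edom g c := K_dom (limit_point_K xc).
have FcE : Fdelta F delta (c, c) = Ms%:E.
  rewrite /Fdelta/= subrr normr0 expr0n/= mulr0 adde0 FE'//.
  by rewrite (Fr_limit_point sigN xc).
split=> //; split; first by rewrite FcE.
have N1 i : (N <= (sig i).-1)%N by have := sigN i; lia.
have E1 i : ((sig i).-1.+1 = sig i)%N by have := sigN i; lia.
have sigoo := subseq_cvgoo sigN.
have Phis : Phi (sig i) @[i --> \oo] --> Ms.
  exact: (cvg_comp _ Phi sigoo Phi_cvg).
have cd : delta *: (x (sig i) - x (sig i).-1) @[i --> \oo] --> (0 : X).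
  rewrite -(scaler0 _ delta) -(subrr c).
  by apply: cvgZr; exact: cvgB.
exists (zseq x \o sig), (fun i => (gradf (x (sig i)) + v (sig i).-1 +
  delta *: (x (sig i) - x (sig i).-1), - (delta *: (x (sig i) - x (sig i).-1)))).
split.
- exact: cvg_pair.
- rewrite FcE; have -> : (fun i => Fdelta F delta ((zseq x \o sig) i)) =
      (fun i => (Phi (sig i))%:E) by apply/funext => i; rewrite /= FdeltaE'.
  by apply: cvg_EFin => //; exact: nearW.
- move=> i; apply: (Fdelta_regular_subdiff ip_norm) => //.
  by have := F_subgradient (N1 i); rewrite E1.
- apply: cvg_pair; last by rewrite -oppr0; exact: cvgN.
  have h := cvgD (subgradient_cvg0 sigN) cd; rewrite addr0 in h.
  exact: h.
Qed.

(** All cluster points of z^k are diagonal, critical and have the value Ms, so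
that KL applies around each of them at the common level Ms. *)
Lemma tail_share_desingularizer : exists N2, share_desingularizer
  (fun k => Phi k - Ms) (fun k => b2 * (s k + s k.-1)) [set k | (N2 <= k)%N].
Proof.
have b20 : 0 <= b2 by rewrite addr_ge0// mulr_ge0.
apply: (@share_desingularizer_compact _ _ (K `*` K) (zseq x)).
- by move=> k; rewrite mulr_ge0// addr_ge0// s_pos.
- exact: compact_setX.
- by move=> k; split; exact: x_K.
move=> [c1 c2] _ /(@cluster_subsequence R _ _ _ N) [sig sigN zc].
have xc1 : x (sig i) @[i --> \oo] --> c1.
  exact: (cvg_comp _ fst zc cvg_fst).
have xc2 : x (sig i).-1 @[i --> \oo] --> c2.
  exact: (cvg_comp _ snd zc cvg_snd).
have sigoo := subseq_cvgoo sigN.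
have c12 : c1 = c2.
  apply/eqP; rewrite -subr_eq0 -normr_eq0; apply/eqP.
  have h1 : s (sig i) @[i --> \oo] --> `|c1 - c2| by apply: cvg_norm; exact: cvgB.
  have h2 : s (sig i) @[i --> \oo] --> 0 by exact: (cvg_comp _ s sigoo s_cvg0).
  exact: (cvg_unique _ h1 h2).
rewrite -c12 in zc xc2 *.
have [FcE crit] := limit_point_Fdelta_critical sigN xc1 xc2.
have [|eta [phi [eta0 dphi KLc]]] := Fdelta_KL (ubar := (c1, c1)).
  by exists (0, 0).
have [|U nU hU] := KL_inequality_integrated dphi KLc; first by rewrite FcE.
exists U => //; exists N.+1.
(* eta may be infinite. *)
have [e' e'0 ee'] : exists2 e' : R, 0 < e' & (e'%:E <= eta)%E.
  move: eta0; case: (eta) => [r| |]//; first by rewrite lte_fin; exists r.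
  by exists 1; rewrite // leey.
exists e', phi; split=> //.
- by have [[h _] _ _ _] := dphi; move=> t t0 te; apply: h; split=> //;
    apply: lt_le_trans ee'; rewrite lte_fin.
- move=> s' t t0 ts se; apply: (desingularizing_homo dphi) => //.
  by apply: lt_le_trans ee'; rewrite lte_fin.
move=> k t [Nk Uk] re t0 tr.
have [|w dw wb] := @Fdelta_subgradient k.-1; first by lia.
have kE : (k.-1.+1 = k)%N by lia.
rewrite kE in dw wb.
have := hU _ w t Uk; rewrite FdeltaE' FcE/= => /(_ isT dw).
have re' : ((Phi k - Ms)%:E < eta)%E by apply: lt_le_trans ee'; rewrite lte_fin.
move=> /(_ re' t0 tr) h; apply: le_trans h _; rewrite ler_wpM2l//.
by rewrite subr_ge0 (desingularizing_homo dphi).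
Qed.

Variables (M : nat -> R) (m : nat) (a C : R).
Hypotheses (a_gt0 : 0 < a)
  (Phi_le_M : forall k i, (k - m <= i <= k)%N -> Phi i <= M k)
  (M_attained : forall k, exists2 l, (k - m <= l <= k)%N & Phi l = M k)
  (descent : forall k, Phi k.+1 + a * (s k.+1 ^+ 2 + s k ^+ 2) <= M k)
  (M_cvg : M k @[k --> \oo] --> Ms) (Ms_le : forall k, Ms <= M k)
  (C_ge0 : 0 <= C)
  (window_steps : \forall k \near \oo,
     s (k + m + 2)%N ^+ 2 <= C * (M k - M (k + 2 * m + 2)%N)).

Let p := (2 * m + 2)%N.
Let e k := Num.sqrt (M k - M (k + p)%N).

Lemma sum_steps_le : exists n1, forall n q, (n1 <= n)%N ->
  \sum_(n + m.+1 <= j < q) `|x j.+1 - x j| <=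
  Num.sqrt C * \sum_(n <= k < q) e k.
Proof.
have [n1 _ hn1] := window_steps.
exists n1 => n q n1n.
have [qn|nq] := leqP q (n + m.+1).
  by rewrite big_geq// mulr_ge0 ?sqrtr_ge0 ?sumr_ge0// => k _; exact: sqrtr_ge0.
rewrite big_addn mulr_sumr.
apply: (@le_trans _ _ (\sum_(n <= k < q - m.+1) Num.sqrt C * e k)).
  rewrite !big_nat; apply: ler_sum => k /andP[nk _].
  have h := hn1 k (leq_trans n1n nk).
  have -> : `|x (k + m.+1).+1 - x (k + m.+1)%N| = s (k + m + 2)%N.
    by rewrite /s addn2 addnS.
  rewrite /e -sqrtrM// -[X in X <= _]ger0_norm// -sqrtr_sqr ler_wsqrtr//.
  by rewrite /p addnA.
rewrite [X in _ <= X](@big_cat_nat _ _ _ (q - m.+1)) ?leq_subr//=; last by lia.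
by rewrite lerDl sumr_ge0// => k _; rewrite mulr_ge0 ?sqrtr_ge0.
Qed.

Lemma x_converges : exists c : X, x k @[k --> \oo] --> c.
Proof.
have b20 : 0 <= b2 by rewrite addr_ge0// mulr_ge0.
have [N2 share] := tail_share_desingularizer.
have [n [T hT]] := sqrt_decrease_summable a_gt0 s_pos Phi_le_M M_attained descent
  M_cvg Ms_le b20 share.
have [n1 hn1] := sum_steps_le.
apply: (@summable_steps_cvg _ _ x K (maxn n n1 + m.+1) (Num.sqrt C * T)) => //.
move=> q; apply: le_trans (hn1 _ q (leq_maxr n n1)) _.
rewrite ler_wpM2l ?sqrtr_ge0//; apply: le_trans (hT q).
have [qn|nq] := leqP q (maxn n n1).
  by rewrite big_geq// sumr_ge0// => k _; exact: sqrtr_ge0.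
rewrite [X in _ <= X](@big_cat_nat _ _ _ (maxn n n1)) ?leq_maxl ?(ltnW nq)//=.
by rewrite lerDr sumr_ge0// => k _; exact: sqrtr_ge0.
Qed.

Section LimitKL.
Variables (xs : X) (x_cvg : x k @[k --> \oo] --> xs).

Let sig i := (N + i).+1.

Let sigN i : (N + i < sig i)%N. Proof. by []. Qed.

Let x_sig : x (sig i) @[i --> \oo] --> xs.
Proof. exact: (cvg_comp _ x (subseq_cvgoo sigN) x_cvg). Qed.

Lemma limit_stationary : stationary ip g gradf xs.
Proof. exact: limit_point_stationary sigN x_sig. Qed.

Lemma zseq_cvg : zseq x k @[k --> \oo] --> (xs, xs).
Proof.
apply: cvg_pair => //; apply: (cvg_comp predn x _ x_cvg).
move=> A [k _ kA]; exists k.+1 => // i /= ki; apply: kA => /=.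
by move: ki; case: i.
Qed.

Variables (theta : R).
Hypotheses (theta_ge : 2^-1 <= theta) (theta_lt1 : theta < 1)
  (F_KL : KL_function_exponent ip theta F).

Lemma derive1_power (c0 t : R) : 0 < t ->
  derive1 (fun t : R => c0 * t `^ (1 - theta)) t =
  c0 * (1 - theta) * (t `^ theta)^-1.
Proof.
move=> t0; rewrite derive1E.
have h := is_derive1_powR (1 - theta) t0.
have -> : (fun t : R => c0 * t `^ (1 - theta)) =
    c0 \*: (fun t => t `^ (1 - theta)).
  by [].
rewrite deriveZ; last by case: h.
rewrite derive_val /GRing.scale/= -mulrA; congr (_ * (_ * _)).
by rewrite addrAC subrr add0r powRN.
Qed.

(** At a peak l one has M (k + p) - Ms = (F (x l) - Ms) + delta / 2 * s l ^ 2.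
If the first summand is positive, KL bounds its power theta by the norm of a
subgradient; the power theta of the second is at most a multiple of s l once s
l <= 1, because 2 theta >= 1. The difference F (x l) - Ms may be negative,
hence the truncation at 0. *)
Lemma peak_value_power_le : exists2 C5, 0 < C5 & \forall k \near \oo,
  (M (k + p)%N - Ms) `^ theta <= C5 * e k.
Proof.
have th0 : 0 < theta by apply: lt_le_trans theta_ge; rewrite invr_gt0.
have FxsE : F xs = Ms%:E.
  by rewrite FE' ?(Fr_limit_point sigN x_sig)//; exact: K_dom (limit_point_K x_sig).
have [|eta [c0 /= [eta0 c00 _ [U nU KLU]]]] := F_KL (ubar := xs).
  by exists 0; exact: limit_point_critical sigN x_sig.
have [e' e'0 ee'] : exists2 e' : R, 0 < e' & (e'%:E <= eta)%E.
  move: eta0; case: (eta) => [r| |]//; first by rewrite lte_fin; exists r.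
  by exists 1; rewrite // leey.
have [N1 _ hN1] : \forall k \near \oo, U (x k) by apply: x_cvg.
have [N2 _ hN2] : \forall k \near \oo, Fr (x k) - Ms < e'.
  have /cvgrPdist_lt /(_ _ e'0) := Fr_cvg; apply: filterS => k.
  by rewrite distrC; apply: le_lt_trans; exact: ler_norm.
have [N3 _ hN3] : \forall k \near \oo, s k <= 2^-1.
  have h2 : 0 < 2^-1 :> R by rewrite invr_gt0.
  have /cvgrPdist_le /(_ _ h2) := s_cvg0; apply: filterS => k.
  by rewrite sub0r normrN ger0_norm// s_pos.
pose A1 := c0 * (1 - theta) * b.
pose A2 := (delta / 2) `^ theta.
have t10 : 0 < 1 - theta by rewrite subr_gt0.
have A10 : 0 <= A1 by rewrite !mulr_ge0// ltW.
have A20 : 0 <= A2 by exact: powR_ge0.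
have q0 : 0 <= Num.sqrt (2 / a) by exact: sqrtr_ge0.
exists (2 * (A1 + A2) * Num.sqrt (2 / a) + 1).
  by rewrite ltr_wpDl// !mulr_ge0// addr_ge0.
exists (N + N1 + N2 + N3).+1 => // k /= hk.
have [l [kl Pl hl]] := peak_steps_le a_gt0 s_pos Phi_le_M M_attained descent k.
have [lN lN1 lN2 [lN3 lN3' lE]] : [/\ (N <= l.-1)%N, (N1 <= l)%N, (N2 <= l)%N &
    [/\ (N3 <= l)%N, (N3 <= l.-1)%N & (l.-1.+1 = l)%N]].
  by clear -hk kl; do !split; lia.
have Ul := hN1 l lN1; have rl := hN2 l lN2.
have sl := hN3 l lN3; have sl1 := hN3 _ lN3'.
set sg := s l + s l.-1 in hl.
have sg0 : 0 <= sg by rewrite addr_ge0// s_pos.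
have sg1 : sg <= 1 by rewrite /sg; lra.
have slsg : s l <= sg by rewrite lerDl s_pos.
pose rho := Num.max 0 (Fr (x l) - Ms).
have rho0 : 0 <= rho by rewrite le_max lexx.
have rho_le : rho `^ theta <= A1 * sg.
  rewrite /rho; have [r0|r0] := leP (Fr (x l) - Ms) 0.
    by rewrite powR0 ?gt_eqF// mulr_ge0.
  have := F_subgradient lN; rewrite lE => /regular_sub_limiting wF.
  have := v_small lN; rewrite lE => wb.
  have /= := KLU _ Ul; rewrite FxsE FE'// lte_fin -subr_gt0 => /(_ r0).
  have -> : ((Fr (x l))%:E < Ms%:E + eta)%E.
    have -> : Fr (x l) = Ms + (Fr (x l) - Ms) by rewrite addrC subrK.
    by rewrite EFinD lteD2lE//; apply: lt_le_trans ee'; rewrite lte_fin.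
  move=> /(_ isT); rewrite -EFinB/= derive1_power// => h1.
  have d0 : 0 < c0 * (1 - theta) * ((Fr (x l) - Ms) `^ theta)^-1.
    by rewrite !mulr_gt0// invr_gt0 powR_gt0.
  have : 1 <= c0 * (1 - theta) * ((Fr (x l) - Ms) `^ theta)^-1 *
      `|gradf (x l) + v l.-1|.
    rewrite -lee_fin; apply: le_trans h1 _; rewrite [X in (_ <= X)%E]EFinM.
    apply: lee_wpmul2l; first by rewrite lee_fin ltW.
    by rewrite -(ipnormE ip_norm); exact: dist0_le wF.
  rewrite mulrAC ler_pdivlMr ?powR_gt0// mul1r => h2.
  apply: le_trans h2 _; rewrite /A1 -[X in _ <= X]mulrA ler_wpM2l//.
  by rewrite mulr_ge0// ltW.
have del_le : (delta / 2 * s l ^+ 2) `^ theta <= A2 * sg.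
  rewrite powRM ?sqr_ge0 ?divr_ge0// ler_wpM2l//.
  rewrite -powR_mulrn ?s_pos// -powRrM.
  have [->|sl0] := eqVneq (s l) 0; first by rewrite powR0// mulf_neq0// gt_eqF.
  have sl_gt0 : 0 < s l by rewrite lt_neqAle eq_sym sl0 s_pos.
  apply: le_trans slsg; rewrite -[X in _ <= X]powRr1 ?s_pos//.
  apply: ger_powR; first by rewrite sl_gt0/=; lra.
  by move: theta_ge; lra.
have del0 : 0 <= delta / 2 * s l ^+ 2 by rewrite mulr_ge0 ?sqr_ge0// divr_ge0.
have ML : M (k + p)%N - Ms <= rho + delta / 2 * s l ^+ 2.
  rewrite -Pl /Phi addrAC lerD2r /rho le_max lexx orbT//.
have ML0 : 0 <= M (k + p)%N - Ms by rewrite subr_ge0.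
pose mx := Num.max rho (delta / 2 * s l ^+ 2).
have mx0 : 0 <= mx by rewrite le_max rho0.
have m1 : rho <= mx by rewrite le_max lexx.
have m2 : delta / 2 * s l ^+ 2 <= mx by rewrite le_max lexx orbT.
have step1 : (M (k + p)%N - Ms) `^ theta <= (2 * mx) `^ theta.
  rewrite ge0_ler_powR ?nnegrE ?(ltW th0) ?mulr_ge0//.
  by apply: le_trans ML _; lra.
have step2 : (2 * mx) `^ theta <= 2 * mx `^ theta.
  rewrite powRM// ler_wpM2r ?powR_ge0//.
  by apply: ler1_powR; [rewrite ler1n|exact: ltW].
have step3 : mx `^ theta <= (A1 + A2) * sg.
  have a1 := mulr_ge0 A10 sg0; have a2 := mulr_ge0 A20 sg0.
  rewrite mulrDl /mx; have [_|_] := leP rho (delta / 2 * s l ^+ 2); lra.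
have e0 : 0 <= e k by exact: sqrtr_ge0.
have A12 : 0 <= A1 + A2 by exact: addr_ge0.
have step4 := ler_wpM2l A12 hl.
apply: le_trans step1 _; apply: le_trans step2 _.
rewrite mulrDl mul1r -!mulrA; move: step3 step4 e0.
rewrite -/(e k); lra.
Qed.

(** The shift by m + 1 between steps and values only costs constant factors: a
power of q in the geometric case, and a power of 2 in the polynomial case,
where k - m - 1 >= k / 2 for large k. *)
Lemma tail_rate : exists C6 q : R, [/\ 0 < C6, 0 < q, q < 1 &
  \forall k \near \oo, forall l,
    \sum_(k <= j < l) `|x j.+1 - x j| <=
    (if theta == 2^-1 then C6 * q ^+ k
     else C6 * k%:R `^ ((1 - theta) / (1 - 2 * theta)))].
Proof.
have [C5 C50 [N5 _ hN5]] := peak_value_power_le.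
have [n1 hn1] := sum_steps_le.
have t10 : 0 < 1 - theta by rewrite subr_gt0.
pose r k := M k - Ms.
have noninc := window_max_noninc a_gt0 Phi_le_M M_attained descent.
have r0 k : 0 <= r k by rewrite subr_ge0.
have rS k : r k.+1 <= r k by rewrite lerD2r noninc.
have p0 : (0 < p)%N by rewrite /p addn2.
have eE k : Num.sqrt (r k - r (k + p)%N) = e k.
  by rewrite /r opprB addrA subrK.
have rec k : (N5 <= k)%N ->
    r (k + p)%N `^ theta <= C5 * Num.sqrt (r k - r (k + p)%N).
  by move=> /hN5; rewrite eE.
have [C1 C10 tail] := tail_le_value_power theta_ge theta_lt1 r0 rS C50 rec.
have [N6 _ hN6] : \forall k \near \oo, r k <= 1.
  have /cvgrPdist_le /(_ _ ltr01) := M_cvg; apply: filterS => k.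
  by rewrite distrC; apply: le_trans; exact: ler_norm.
have main k l : (n1 + N5 + N6 + m.+1 <= k)%N ->
    \sum_(k <= j < l) `|x j.+1 - x j| <=
    Num.sqrt C * C1 * r (k - m.+1)%N `^ (1 - theta).
  move=> hk; have {1}-> : (k = k - m.+1 + m.+1)%N by clear -hk; lia.
  have [k1 k2 k3] :
    [/\ (n1 <= k - m.+1)%N, (N5 <= k - m.+1)%N & (N6 <= k - m.+1)%N].
    by clear -hk; split; lia.
  apply: le_trans (hn1 _ _ k1) _.
  rewrite -mulrA ler_wpM2l ?sqrtr_ge0//.
  under eq_bigr do rewrite -eE.
  by apply: tail => //; exact: hN6.
have C20 : 0 <= Num.sqrt C * C1 by rewrite mulr_ge0 ?sqrtr_ge0.
have [tE|tN] := eqVneq theta 2^-1.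
  have [A [t [A0 t0 t1 hA]]] := values_geometric p0 r0 rS C50 rec tE.
  pose q := Num.sqrt t.
  have q0 : 0 < q by rewrite sqrtr_gt0.
  have q1 : q < 1 by rewrite -sqrtr1 ltr_sqrt.
  exists (Num.sqrt C * C1 * Num.sqrt A / q ^+ m.+1 + 1), q; split=> //.
    by rewrite ltr_wpDl// divr_ge0 ?exprn_ge0 ?sqrtr_ge0// mulr_ge0// sqrtr_ge0.
  exists (n1 + N5 + N6 + m.+1)%N => // k /= hk l.
  apply: le_trans (main k l hk) _.
  have -> : 1 - theta = 2^-1 by rewrite tE; lra.
  rewrite powR12_sqrt//.
  have h : Num.sqrt (r (k - m.+1)%N) <= Num.sqrt A * q ^+ (k - m.+1).
    have k5 : (N5 <= k - m.+1)%N by clear -hk; lia.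
    apply: le_trans (ler_wsqrtr (hA _ k5)) _.
    rewrite sqrtrM ?(ltW A0)// ler_wpM2l ?sqrtr_ge0//.
    rewrite -[X in _ <= X]ger0_norm ?exprn_ge0 ?(ltW q0)// -sqrtr_sqr.
    by rewrite -exprM mulnC exprM sqr_sqrtr// ltW.
  apply: le_trans (ler_wpM2l C20 h) _.
  have -> : q ^+ k = q ^+ (k - m.+1) * q ^+ m.+1.
    rewrite -exprD subnK//.
    by clear -hk; lia.
  rewrite mulrDl mul1r [_ / _ * _]mulrAC -!mulrA mulfV ?mulr1; last first.
    by rewrite expf_neq0// gt_eqF.
  by rewrite !mulrA lerDl mulr_ge0 ?exprn_ge0// ltW.
have t2 : 2^-1 < theta by rewrite lt_neqAle eq_sym tN.
have [A A0 hA] := values_polynomial p0 r0 rS C50 rec t2.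
pose ka := (1 - theta) / (2 * theta - 1).
have ka0 : 0 < ka by rewrite divr_gt0//; move: t2; lra.
have kE : (1 - theta) / (1 - 2 * theta) = - ka.
  by rewrite -[1 - 2 * theta]opprB invrN mulrN.
exists (Num.sqrt C * C1 * A `^ (1 - theta) * 2 `^ ka + 1), 2^-1; split.
- by rewrite ltr_wpDl// !mulr_ge0 ?powR_ge0 ?sqrtr_ge0.
- by rewrite invr_gt0.
- by rewrite invf_lt1// ltr1n.
exists (n1 + N5 + N6 + m.+1 + 2 * (N5 + p) + 2 * m.+1)%N => // k /= hk l.
have [k1 k2 k3 k4] : [/\ (n1 + N5 + N6 + m.+1 <= k)%N, (0 < k - m.+1)%N,
    (2 * (N5 + p) <= k - m.+1)%N & (k <= (k - m.+1) * 2)%N].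
  by clear -hk p0; split; lia.
apply: le_trans (main k l k1) _; rewrite kE.
have k0 : 0 < k%:R :> R by rewrite ltr0n (leq_trans k2)// leq_subr.
have kn0 : 0 < (k - m.+1)%:R :> R by rewrite ltr0n.
have h1 : r (k - m.+1)%N `^ (1 - theta) <=
    A `^ (1 - theta) * (k - m.+1)%:R `^ (- ka).
  apply: le_trans (ge0_ler_powR (ltW t10) _ _ (hA _ k3)) _.
  - by rewrite nnegrE.
  - by rewrite nnegrE mulr_ge0 ?powR_ge0// ltW.
  rewrite powRM ?powR_ge0 ?(ltW A0)// ler_wpM2l ?powR_ge0//.
  by rewrite -powRrM mulNr [_^-1 * _]mulrC.
have h2 : (k - m.+1)%:R `^ (- ka) <= 2 `^ ka * k%:R `^ (- ka).
  have kh : k%:R / 2 <= (k - m.+1)%:R :> R.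
    by rewrite ler_pdivrMr// -natrM ler_nat.
  have k20 : 0 < k%:R / 2 :> R by rewrite divr_gt0.
  have -> : 2 `^ ka * k%:R `^ (- ka) = (k%:R / 2 : R) `^ (- ka).
    rewrite powRM ?invr_ge0 ?(ltW k0)// mulrC.
    by rewrite -(powR_inv1 (ler0n R 2)) -powRrM mulN1r opprK.
  rewrite !powRN lef_pV2 ?posrE ?powR_gt0//.
  exact: (ge0_ler_powR (ltW ka0) (ltW k20) (ltW kn0) kh).
rewrite mulrDl mul1r -!mulrA.
apply: le_trans (_ : Num.sqrt C * (C1 * (A `^ (1 - theta) *
  (2 `^ ka * k%:R `^ (- ka)))) <= _).
  rewrite ler_wpM2l ?sqrtr_ge0// ler_wpM2l//; apply: le_trans h1 _.
  by rewrite ler_wpM2l ?powR_ge0.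
by rewrite lerDl powR_ge0.
Qed.

End LimitKL.

Lemma convergence_with_rate : exists xs : X,
  [/\ zseq x k @[k --> \oo] --> (xs, xs), stationary ip g gradf xs &
    forall theta : R, 2^-1 <= theta -> theta < 1 ->
      KL_function_exponent ip theta F ->
      exists C6 q : R, [/\ 0 < C6, 0 < q, q < 1 &
        \forall k \near \oo,
          ((`|x k - xs|)%:E <= \sum_(k <= j <oo) (`|x j.+1 - x j|)%:E)%E /\
          (\sum_(k <= j <oo) (`|x j.+1 - x j|)%:E <=
             (if theta == 2^-1 then C6 * q ^+ k
              else C6 * k%:R `^ ((1 - theta) / (1 - 2 * theta)))%:E)%E]].
Proof.
have [xs xxs] := x_converges; exists xs; split.
- exact: zseq_cvg.
- exact: limit_stationary.
move=> theta th1 th2 FKL.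
have [C6 [q [C60 q0 q1 hk]]] := tail_rate xxs th1 th2 FKL.
exists C6, q; split=> //; apply: filterS hk => k hk; split.
  exact: dist_limit_le_series.
exact: series_le.
Qed.

End Convergence.

(** * The line search method *)

Section ExtendedRealPrelim.
Variable R : realType.

Lemma lower_semicontinuous_add (X : topologicalType) (f g : X -> \bar R) :
  (forall u, -oo < f u)%E -> (forall u, -oo < g u)%E ->
  lower_semicontinuous f -> lower_semicontinuous g ->
  lower_semicontinuous (fun u => f u + g u)%E.
Proof.
move=> fNy gNy flsc glsc x a afg.
have [b [c [bf cg abc]]] : exists b c : R,
    [/\ (b%:E < f x)%E, (c%:E < g x)%E & a <= b + c].
  have := fNy x; have := gNy x; move: afg.
  case: (f x) => [r| |]; case: (g x) => [s| |]//.
  - rewrite -EFinD lte_fin => ars _ _.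
    exists (r - (r + s - a) / 2), (s - (r + s - a) / 2).
    by rewrite !lte_fin; split; lra.
  - by move=> _ _ _; exists (r - 1), (a - r + 1);
      rewrite lte_fin ltry; split=> //; lra.
  - by move=> _ _ _; exists (a - s + 1), (s - 1);
      rewrite lte_fin ltry; split=> //; lra.
  - by move=> _ _ _; exists a, 0; rewrite !ltry addr0.
have [V nV hV] := flsc _ _ bf; have [W nW hW] := glsc _ _ cg.
exists (V `&` W); first exact: filterI.
move=> u [/hV bu /hW cu]; apply: (@le_lt_trans _ _ (b + c)%:E).
  by rewrite lee_fin.
by rewrite EFinD lteD.
Qed.

Lemma closed_sublevel (X : topologicalType) (f : X -> \bar R) (a : R) :
  lower_semicontinuous f -> closed [set u | (f u <= a%:E)%E].
Proof.
move=> /lower_semicontinuousP /(_ a) of_.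
have -> : [set u | (f u <= a%:E)%E] = ~` [set u | (a%:E < f u)%E].
  by apply/seteqP; split=> u /=; rewrite leNgt => /negP.
exact: open_closedC.
Qed.

Lemma bigmaxe_attained (u : nat -> R) (v : nat -> \bar R) a b : (a < b)%N ->
  (forall i, v i = (u i)%:E) ->
  exists l, [/\ (a <= l < b)%N,
    \big[maxe/-oo%E]_(a <= i < b) v i = (u l)%:E &
    forall i, (a <= i < b)%N -> u i <= u l].
Proof.
move=> ab uv; elim: b ab => [//|b ih]; rewrite ltnS leq_eqVlt => /orP[/eqP ->|ab].
  exists b; split; [by rewrite leqnn ltnSn| |].
    by rewrite big_nat1.
  by move=> i; rewrite ltnS -eqn_leq => /eqP ->.
have [l [/andP[al lb] E ub]] := ih ab.
have [ul|ul] := leP (u l) (u b).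
  exists b; split; first by rewrite ltnSn ltnW.
    rewrite big_nat_recr; last exact: ltnW.
    by rewrite /= E uv; apply/max_idPr; rewrite lee_fin.
  move=> i; rewrite ltnS [(i <= b)%N]leq_eqVlt => /andP[ai /orP[/eqP->//|ib]].
  by apply: le_trans ul; apply: ub; rewrite ai.
exists l; split; first by rewrite al ltnS ltnW.
  rewrite big_nat_recr; last exact: ltnW.
  by rewrite /= E uv; apply/max_idPl; rewrite lee_fin ltW.
move=> i; rewrite ltnS [(i <= b)%N]leq_eqVlt => /andP[ai /orP[/eqP->|ib]].
  exact: ltW.
by apply: ub; rewrite ai.
Qed.

End ExtendedRealPrelim.

Section Method.
Variables (R : realType) (X : normedModType R) (n : nat)
  (Xfin : Vector.axiom n X) (ip : {dot X for idfun})
  (ip_norm : forall x : X, `|x| = Num.sqrt (ip x x))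
  (f g : X -> \bar R) (O : set X) (gradf : X -> X)
  (f_proper : proper_fun f) (f_lsc : lower_semicontinuous f)
  (O_open : open O) (dom_g_O : edom g `<=` O)
  (f_C1 : continuously_differentiable_on ip O f gradf)
  (gradf_lip : strictly_continuous_on O gradf)
  (g_proper : proper_fun g) (g_lsc : lower_semicontinuous g)
  (g_bnd : bounded_below g)
  (F_bnd : bounded_below (fun x => (f x + g x)%E))
  (m : nat) (delta alpha gmin gmax bmax rho nu : R)
  (delta_gt0 : 0 < delta)
  (alpha_gt0 : 0 < alpha) (alpha_lt1 : alpha < 1)
  (gmin_gt0 : 0 < gmin)
  (bmax_le1 : bmax <= 1)
  (rho_gt1 : 1 < rho) (nu_gt0 : 0 < nu) (nu_lt : nu < rho^-1)
  (x : nat -> X) (x0_dom : edom g (x 0%N)).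
Variables (beta0 gamma0 : nat -> R) (xt : nat -> nat -> X) (jk : nat -> nat).

Let F u := (f u + g u)%E.
Let beta k j := beta0 k * nu ^+ j.
Let gamma k j := gamma0 k * rho ^+ j.
Let y k j := x k + beta k j *: (x k - x k.-1).

Hypothesis run : forall k : nat,
      [/\ 0 <= beta0 k <= bmax,
          gmin <= gamma0 k <= gmax,
          (forall j, (j <= jk k)%N -> O (y k j) /\
             forall u, (prox_model ip f g gradf (y k j) (gamma k j) (xt k j)
                        <= prox_model ip f g gradf (y k j) (gamma k j) u)%E),
          (forall j, (j < jk k)%N ->
             ~ line_search_test F m delta alpha x k (gamma k j) (xt k j)) &
          line_search_test F m delta alpha x k (gamma k (jk k)) (xt k (jk k))
          /\ x k.+1 = xt k (jk k)].
Hypothesis level_bounded : bounded_set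
       [set z : X * X | (Fdelta F delta z <= Fdelta F delta (zseq x 0))%E].

Let Fr u := fine (f u) + fine (g u).
Let s k := `|x k - x k.-1|.
Let Phi k := Fr (x k) + delta / 2 * s k ^+ 2.
Let M k := fine (\big[maxe/-oo%E]_((k - m)%N <= i < k.+1)
                    Fdelta F delta (zseq x i)).

Lemma g_gtNy u : (-oo < g u)%E. Proof. by case: g_proper. Qed.

Lemma f_fin u : edom g u -> f u \is a fin_num.
Proof. by move=> /dom_g_O; case: f_C1 => h _ _; exact: h. Qed.

Lemma g_fin u : edom g u -> g u \is a fin_num.
Proof. by move=> gu; rewrite fin_numE gt_eqF ?g_gtNy// lt_eqF. Qed.

Lemma FE u : edom g u -> F u = (Fr u)%:E.
Proof. by move=> gu; rewrite EFinD !fineK ?f_fin ?g_fin. Qed.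

Lemma domF u : (F u < +oo)%E -> edom g u.
Proof.
have [fNy _] := f_proper; have := fNy u; have := g_gtNy u.
by rewrite /F /edom/=; case: (f u) => [r| |]; case: (g u).
Qed.

Lemma trial_prox k j : (j <= jk k)%N -> edom g (xt k j) /\
  forall u, edom g u ->
    fine (g (xt k j)) + ip (gradf (y k j)) (xt k j - y k j) +
      gamma k j / 2 * `|xt k j - y k j| ^+ 2 <=
    fine (g u) + ip (gradf (y k j)) (u - y k j) +
      gamma k j / 2 * `|u - y k j| ^+ 2.
Proof.
have [_ _ h _ _] := run k => /h [Oy opt].
apply: prox_optimality opt; first by case: f_C1 => ffin _ _; exact: ffin.
  exact: g_gtNy.
by exists (x 0).
Qed.

Lemma x_dom k : edom g (x k).
Proof.
case: k => [//|k]; have [_ _ _ _ [_ ->]] := run k.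
by have [] := trial_prox (leqnn (jk k)).
Qed.

Lemma FdeltaE k : Fdelta F delta (zseq x k) = (Phi k)%:E.
Proof. by rewrite /Fdelta/= FE//; exact: x_dom. Qed.

Lemma window_max k : exists l, [/\ (k - m <= l <= k)%N,
    \big[maxe/-oo%E]_((k - m)%N <= i < k.+1) Fdelta F delta (zseq x i)
      = (M k)%:E, Phi l = M k &
    forall i, (k - m <= i <= k)%N -> Phi i <= M k].
Proof.
have [|l [lk E ub]] := @bigmaxe_attained R Phi _ (k - m) k.+1 _ FdeltaE.
  by rewrite ltnS leq_subr.
by exists l; rewrite /M E/=; split.
Qed.

Lemma Phi_le_M k i : (k - m <= i <= k)%N -> Phi i <= M k.
Proof. by have [l [_ _ _]] := window_max k; exact. Qed.

Lemma M_attained k : exists2 l, (k - m <= l <= k)%N & Phi l = M k.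
Proof. by have [l []] := window_max k; exists l. Qed.

Lemma line_search_testE k gam u : edom g u ->
  line_search_test F m delta alpha x k gam u <->
  Fr u + delta / 2 * `|u - x k| ^+ 2 <=
    M k - alpha * gam / 2 * `|u - x k| ^+ 2 - alpha * delta / 2 * s k ^+ 2.
Proof.
move=> gu; rewrite /line_search_test /Fdelta/= FE//.
have [l [_ E _ _]] := window_max k.
by rewrite /Fdelta/= in E; rewrite E -!EFinD lee_fin.
Qed.

Lemma gamma_ge k j : gmin <= gamma k j.
Proof.
have [_ /andP[h _] _ _ _] := run k; apply: le_trans h _.
rewrite ler_peMr ?exprn_ege1 ?ltW//.
by have [_ /andP[h _] _ _ _] := run k; exact: lt_le_trans h.
Qed.

Lemma beta_itv k j : 0 <= beta k j <= 1.
Proof.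
have [/andP[b0 b1] _ _ _ _] := run k.
have nu1 : nu <= 1.
  by apply: le_trans (ltW nu_lt) _; rewrite invf_le1 ?ltW// (lt_trans ltr01).
have nj : nu ^+ j <= 1 by rewrite exprn_ile1// ltW.
rewrite mulr_ge0 ?exprn_ge0 ?(ltW nu_gt0)//= mulr_ile1 ?exprn_ge0 ?(ltW nu_gt0)//.
exact: le_trans bmax_le1.
Qed.

(** The product starts below gmax and is multiplied by rho nu < 1 at each
trial; so the contribution of extrapolation stays bounded however large gamma
gets. *)
Lemma gamma_beta_le k j : 0 <= gamma k j * beta k j <= gmax.
Proof.
have [/andP[b0 b1] /andP[g0 g1] _ _ _] := run k.
have /andP[bk _] := beta_itv k j.
have gk := le_trans (ltW gmin_gt0) (gamma_ge k j).
rewrite mulr_ge0//= /gamma /beta mulrACA -exprMn.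
have rho0 : 0 < rho by exact: lt_trans rho_gt1.
have rn1 : (rho * nu) ^+ j <= 1.
  rewrite exprn_ile1 ?mulr_ge0 ?ltW//.
  by move: nu_lt; rewrite -[rho^-1]mul1r ltr_pdivlMr// mulrC.
have gg : 0 <= gamma0 k by apply: le_trans g0; exact: ltW.
apply: (@le_trans _ _ (gamma0 k * 1)); last by rewrite mulr1.
rewrite -mulrA ler_wpM2l// mulr_ile1//.
  by rewrite exprn_ge0// mulr_ge0// ltW.
exact: le_trans bmax_le1.
Qed.

Let a := alpha * Num.min gmin delta / 2.

Lemma a_gt0 : 0 < a.
Proof. by rewrite divr_gt0// mulr_gt0// lt_min gmin_gt0. Qed.

Lemma descent k : Phi k.+1 + a * (s k.+1 ^+ 2 + s k ^+ 2) <= M k.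
Proof.
have [_ _ _ _ [+ xE]] := run k.
have gk := gamma_ge k (jk k).
have gx := x_dom k.+1; rewrite xE in gx.
move=> /(line_search_testE _ _ gx); rewrite -xE => h.
rewrite /Phi/= {1}/s/=.
have m1 : Num.min gmin delta <= gamma k (jk k).
  by apply: le_trans gk; rewrite ge_min lexx.
have m2 : Num.min gmin delta <= delta by rewrite ge_min lexx orbT.
have n1 := sqr_ge0 (s k.+1); have n2 := sqr_ge0 (s k).
have := ler_wpM2r n1 (ler_wpM2l (ltW alpha_gt0) m1).
have := ler_wpM2r n2 (ler_wpM2l (ltW alpha_gt0) m2).
rewrite /a; move: h; rewrite /s/=; lra.
Qed.

Lemma s0 : s 0 = 0. Proof. by rewrite /s/= subrr normr0. Qed.

Lemma s_ge0 k : 0 <= s k. Proof. exact: normr_ge0. Qed.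

Lemma Fr_le0 k : Fr (x k) <= Fr (x 0).
Proof.
have P0 : Fr (x 0) = Phi 0 by rewrite /Phi s0 expr0n/= mulr0 addr0.
have h1 : Fr (x k) <= Phi k.
  by rewrite /Phi lerDl mulr_ge0 ?sqr_ge0// divr_ge0// ltW.
rewrite P0; apply: le_trans h1 _; apply: (@le_trans _ _ (M k)).
  by apply: Phi_le_M; rewrite leq_subr leqnn.
apply: (@le_trans _ _ (M 0)).
  by apply: (window_max_noninc a_gt0 Phi_le_M M_attained descent).
have [l] := M_attained 0; rewrite sub0n leqn0 => /eqP -> <-.
exact: lexx.
Qed.

Let K := [set u | (F u <= (Fr (x 0))%:E)%E].

Lemma K_compact : compact K.
Proof.
apply: (findim_bounded_closed_compact Xfin).
  have [B [Breal hB]] := level_bounded.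
  exists B; split=> // b Bb u Ku.
  apply: le_trans (hB b Bb (u, u) _); last first.
    rewrite /Fdelta/= !subrr !normr0 expr0n/= !mulr0 !adde0.
    by rewrite (FE x0_dom).
  by rewrite prod_normE/= le_max lexx.
apply: closed_sublevel; apply: lower_semicontinuous_add => //.
  by case: f_proper.
exact: g_gtNy.
Qed.

Lemma K_dom u : K u -> edom g u.
Proof. by move=> Ku; apply: domF; apply: le_lt_trans Ku _; rewrite ltry. Qed.

Lemma x_K k : K (x k).
Proof. by rewrite /K/= FE ?lee_fin ?Fr_le0//; exact: x_dom. Qed.

(** A single B plays the roles of inverse radius, Lipschitz constant and bound;
all four properties become weaker as B increases. *)
Let uniform_const (B : R) := forall u, K u ->
  [/\ (forall v, `|v - u| < B^-1 -> O v),
      (forall v w, `|v - u| < B^-1 -> `|w - u| < B^-1 ->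
         `|gradf v - gradf w| <= B * `|v - w|),
      `|gradf u| <= B & - B <= fine (f u)].

(** Near each point of K the properties hold for all large B, and compactness
makes the choice of B uniform. *)
Lemma uniform_constant : exists2 B : R, 0 < B & uniform_const B.
Proof.
pose P (B : R) (u : X) := [/\ (forall v, `|v - u| < B^-1 -> O v),
      (forall v w, `|v - u| < B^-1 -> `|w - u| < B^-1 ->
         `|gradf v - gradf w| <= B * `|v - w|),
      `|gradf u| <= B & - B <= fine (f u)].
have /compact_near_coveringP /(_ R +oo P) := K_compact.
suff loc : forall u, K u -> \forall u' \near u & B \near +oo, P B u'.
  move=> /(_ _ loc) hK; near (pinfty_nbhs R) => B; exists B.
    by near: B; exact: nbhs_pinfty_gt.
  by move=> u Ku; apply: (near hK B) => //; near: B.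
move=> u /K_dom/dom_g_O Ou.
have [L [U [nU LU]]] := gradf_lip Ou.
have [_ fgrad gcont] := f_C1.
have nO : nbhs u O by exact: open_nbhs_nbhs.
have n1 : \forall v \near u, `|gradf v| <= `|gradf u| + 1.
  have /cvgrPdist_le /(_ _ ltr01) := gcont _ Ou.
  apply: filterS => v hv; rewrite -lerBlDl.
  apply: le_trans hv; rewrite distrC; exact: lerB_dist.
have n2 : \forall v \near u, fine (f u) - 1 <= fine (f v).
  have [df _] := fgrad _ Ou.
  have /cvgrPdist_le /(_ _ ltr01) := differentiable_continuous df.
  apply: filterS => v /=; rewrite ler_norml => /andP[_]; lra.
have : nbhs u ((O `&` U) `&` ([set v | `|gradf v| <= `|gradf u| + 1] `&`
    [set v | fine (f u) - 1 <= fine (f v)])).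
  by apply: filterI; exact: filterI.
rewrite -nbhs_ballE => -[r /= r0 hr].
pose B1 := (r / 2)^-1 + `|L| + (`|gradf u| + 1) + `|fine (f u) - 1|.
have r20 : 0 < (r / 2)^-1 by rewrite invr_gt0 divr_gt0.
have nB : \forall B \near +oo, B1 <= B by apply: nbhs_pinfty_ge; exact: num_real.
near=> u' B.
have B1B : B1 <= B by near: B.
have [[L1 f1] [n1' n2' n3']] :
    (L <= `|L| /\ - (fine (f u) - 1) <= `|fine (f u) - 1|) /\
    [/\ 0 <= `|L|, 0 <= `|gradf u| & 0 <= `|fine (f u) - 1|].
  by rewrite !ler_norm !normr_ge0 -normrN ler_norm.
have B0 : 0 < B by apply: lt_le_trans B1B; rewrite /B1; lra.
have Br : B^-1 <= r / 2.
  have rB : (r / 2)^-1 <= B by apply: le_trans B1B; rewrite /B1; lra.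
  by rewrite -lef_pV2 ?posrE ?invr_gt0 ?divr_gt0// invrK.
have uu' : `|u - u'| < r / 2.
  by near: u'; apply: cvgr_dist_lt; rewrite ?divr_gt0.
have inU v : `|v - u'| < B^-1 -> ball u r v.
  move=> vu; rewrite -ball_normE/= -(subrK u' u) -addrA.
  apply: le_lt_trans (ler_normD _ _) _.
  by rewrite [r]splitr ltrD// distrC; apply: lt_le_trans Br.
have u'r : ball u r u' by apply: inU; rewrite subrr normr0 invr_gt0.
have [[_ _] [h1 h2]] := hr _ u'r.
split.
- by move=> v /inU /hr[[]].
- move=> v w /inU/hr[[_ Uv] _] /inU/hr[[_ Uw] _].
  apply: le_trans (LU (v, w) _) _; first by split.
  by rewrite ler_wpM2r//=; apply: le_trans B1B; rewrite /B1; lra.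
- by apply: le_trans h1 _; apply: le_trans B1B; rewrite /B1; lra.
- by move: h2 B1B; rewrite /B1/=; lra.
Unshelve. all: end_near. Qed.

Lemma y_near k j : `|x k - y k j| <= s k.
Proof.
have /andP[b0 b1] := beta_itv k j.
by rewrite /y opprD addrA subrr add0r normrN normrZ ger0_norm// ler_piMl.
Qed.

(** The proximal model compared at the trial point and at x k. Its squared
distances are taken to y and not to x k; the difference is a cross term whose
factor is gamma beta. *)
Lemma trial_vs_center k j : (j <= jk k)%N ->
  fine (g (xt k j)) <= fine (g (x k)) - ip (gradf (y k j)) (xt k j - x k) -
    gamma k j / 2 * `|xt k j - x k| ^+ 2 + gmax * (`|xt k j - x k| * s k).
Proof.
move=> jj; have [_ opt] := trial_prox jj.
have /andP[gb0 gb1] := gamma_beta_le k j.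
have h2 := opt _ (x_dom k).
set p := xt k j - x k.
pose d := x k - x k.-1.
have uE : xt k j - y k j = p - beta k j *: d.
  by rewrite /y /p opprD addrA.
have xE : x k - y k j = - (beta k j *: d) by rewrite /y opprD addrA subrr add0r.
rewrite uE xE normrN (normB_sq ip_norm p) (ipDr ip p) !(ipNr ip) !(ipZr ip) in h2.
have h4 := ler_wpM2l gb0 (ip_le_norm ip_norm p d).
have h5 : gamma k j * beta k j * (`|p| * `|d|) <= gmax * (`|p| * `|d|).
  by rewrite ler_wpM2r// mulr_ge0.
have sE : s k = `|d| by [].
move: h2 h4 h5; rewrite sE; lra.
Qed.

Lemma gradf_y_le B k j : 0 < B -> uniform_const B -> s k < B^-1 ->
  `|gradf (y k j)| <= B + 1.
Proof.
move=> B0 hB sB; have [_ hL hG _] := hB _ (x_K k).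
have yx := y_near k j.
have := hL (y k j) (x k).
rewrite subrr normr0 invr_gt0 distrC => /(_ (le_lt_trans yx sB) B0) h.
rewrite -(subrK (gradf (x k)) (gradf (y k j))).
apply: le_trans (ler_normD _ _) _; rewrite addrC lerD//.
apply: le_trans h _; rewrite -ler_pdivlMl// mulr1.
exact: ltW (le_lt_trans yx sB).
Qed.

Lemma trial_decrease B k j : 0 < B -> uniform_const B ->
  (j <= jk k)%N -> s k < B^-1 -> `|xt k j - x k| < B^-1 ->
  Fr (xt k j) <= Fr (x k) + (B - gamma k j / 2) * `|xt k j - x k| ^+ 2 +
    (gmax + B) * s k * `|xt k j - x k|.
Proof.
move=> B0 hB jj sB tB.
have [hO hL _ _] := hB _ (x_K k).
have yx := y_near k j.
have [_ fgrad _] := f_C1.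
have h1 := @descent_on_ball _ _ _ ip_norm f gradf (x k) (x k) (xt k j) (y k j)
  B^-1 B (fun v hv => fgrad v (hO v hv)) hL (ltW B0).
have {h1} := h1 _ tB _.
rewrite subrr normr0 invr_gt0 => /(_ B0).
rewrite distrC => /(_ (le_lt_trans yx sB)) h1.
have h2 := trial_vs_center jj.
set p := xt k j - x k in tB h1 h2 *.
have h6 : B * (`|p| + `|x k - y k j|) * `|p| <= B * (`|p| + s k) * `|p|.
  by rewrite ler_wpM2r// ler_wpM2l ?(ltW B0)// lerD2l.
rewrite /Fr; move: h1 h2 h6; lra.
Qed.

(** The term in gamma has a favourable sign and is dropped. This is why Phi
cannot grow by more than squared steps although no bound on gamma is known yet.
*)
Lemma step_growth B : 0 < B ->
  uniform_const B ->
  forall k, s k < B^-1 -> s k.+1 < B^-1 ->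
  Phi k.+1 <= Phi k + (2 * B + gmax + delta) * (s k.+1 ^+ 2 + s k ^+ 2).
Proof.
move=> B0 hB k sk sk1.
have [_ /andP[g0 g1] _ _ [_ xE]] := run k.
rewrite {1}/s/= xE in sk1.
have := trial_decrease B0 hB (leqnn (jk k)) sk sk1.
rewrite -xE -/(s k.+1) /Phi.
have gk : 0 <= gamma k (jk k) by apply: le_trans (gamma_ge _ _); exact: ltW.
have gm : 0 <= gmax by apply: le_trans g1; apply: le_trans g0; exact: ltW.
have n1 := sqr_ge0 (s k.+1); have n2 := sqr_ge0 (s k).
have n3 := mulr_ge0 gk n1.
have n4 : 2 * (s k * s k.+1) <= s k.+1 ^+ 2 + s k ^+ 2.
  by have := sqr_ge0 (s k - s k.+1); lra.
have n5 : 0 <= gmax + B by lra.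
have := ler_wpM2l n5 n4.
have := mulr_ge0 (ltW delta_gt0) n1; have := mulr_ge0 (ltW delta_gt0) n2.
have := mulr_ge0 (ltW B0) n1; have := mulr_ge0 (ltW B0) n2.
have := mulr_ge0 gm n1; have := mulr_ge0 gm n2.
lra.
Qed.

Lemma Phi_lb : exists b, forall k, b <= Phi k.
Proof.
have [b hb] := F_bnd; exists b => k; have := hb (x k).
rewrite -[X in (_ <= X)%E]/(F (x k)) FE ?lee_fin; last exact: x_dom.
move=> /le_trans; apply.
by rewrite /Phi lerDl mulr_ge0 ?sqr_ge0// divr_ge0// ltW.
Qed.

Lemma asymptotic_regularity : exists Ms : R,
  [/\ forall k, Ms <= M k, M k @[k --> \oo] --> Ms,
      Phi k @[k --> \oo] --> Ms,
      (forall e, 0 < e -> \forall k \near \oo, s k < e) &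
      exists2 C, 0 <= C & \forall k \near \oo,
        s (k + m + 2)%N ^+ 2 <= C * (M k - M (k + 2 * m + 2)%N)].
Proof.
have [B B0 hB] := uniform_constant.
have gr := step_growth B0 hB.
have c0 : 0 <= 2 * B + gmax + delta.
  have [_ /andP[g0 g1] _ _ _] := run 0.
  have : 0 <= gmax by apply: le_trans g1; apply: le_trans g0; exact: ltW.
  by move: B0 delta_gt0; lra.
have Bi : 0 < B^-1 by rewrite invr_gt0.
have [Ms cM MsM] := window_max_cvg a_gt0 Phi_le_M M_attained descent Phi_lb.
exists Ms; split=> //.
- exact: (values_cvg a_gt0 s_ge0 Phi_le_M M_attained descent Phi_lb c0 Bi gr).
- exact: (steps_cvg0 a_gt0 s_ge0 Phi_le_M M_attained descent Phi_lb c0 Bi gr).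
have [C C0 hC] := steps_le_window_decrease a_gt0 s_ge0 Phi_le_M M_attained
  descent Phi_lb c0 Bi gr.
by exists C => //; apply: filterS hC => k [].
Qed.

(** For large k a rejected trial has gamma <= G, and the accepted gamma is
either the initial one or rho times the last rejected one. If gamma is beyond
G1, then g bounded below forces the trial point to be close to x k; if it is
beyond G2 as well, the trial decreases F enough to pass the test. *)
Lemma stepsize_bounded : exists2 G : R, 0 <= G &
  \forall k \near \oo, gamma k (jk k) <= G.
Proof.
have [B B0 hB] := uniform_constant.
have [cg hcg] := g_bnd.
have gm0 : 0 <= gmax.
  have [_ /andP[g0 g1] _ _ _] := run 0.
  by apply: le_trans g1; apply: le_trans g0; exact: ltW.
have al : 0 < 1 - alpha by rewrite subr_gt0.
pose c2 := `|Fr (x 0)| + B + `|cg|.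
pose c3 := B + 1 + gmax * B^-1.
pose kap := (1 - alpha) * delta / 2.
have kap0 : 0 < kap by rewrite divr_gt0// mulr_gt0.
pose G1 := 2 * (c2 * B ^+ 2 + c3 * B).
pose G2 := 2 * (B + delta / 2 + (gmax + B) ^+ 2 / (4 * kap)) / (1 - alpha).
pose G := Num.max G1 G2.
have Bi0 : 0 < B^-1 by rewrite invr_gt0.
have c20 : 0 <= c2 by rewrite !addr_ge0// ltW.
have c30 : 0 <= c3 by rewrite !addr_ge0 ?mulr_ge0// ltW.
have rej k j : s k < B^-1 -> (j < jk k)%N -> gamma k j <= G.
  move=> sB jj; rewrite leNgt; apply/negP; rewrite gt_max => /andP[gG1 gG2].
  have [gu _] := trial_prox (ltnW jj).
  have tc := trial_vs_center (ltnW jj).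
  have [_ _ _ frx] := hB _ (x_K k).
  set p := xt k j - x k in tc; set t := `|p| in tc.
  have t0 : 0 <= t by exact: normr_ge0.
  have tB : t < B^-1.
    rewrite ltNge; apply/negP => Bt.
    (* Far away the quadratic term of the model would dominate the others, which
       grow at most linearly. *)
    have Bt1 : 1 <= B * t by rewrite -ler_pdivrMl// mulr1.
    have e1 : - ip (gradf (y k j)) p <= (B + 1) * t.
      apply: le_trans (_ : `|gradf (y k j)| * t <= _); last first.
        by rewrite ler_wpM2r//; exact: gradf_y_le.
      by apply: le_trans (cauchy_schwarz ip_norm _ _); rewrite -normrN ler_norm.
    have e2 : fine (g (x k)) <= `|Fr (x 0)| + B.
      apply: le_trans (_ : Fr (x k) + B <= _).
        by rewrite /Fr; move: frx; lra.
      by rewrite lerD2r; apply: le_trans (Fr_le0 k) (ler_norm _).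
    have e3 : - `|cg| <= fine (g (xt k j)).
      have := hcg (xt k j); rewrite -(fineK (g_fin gu)) lee_fin.
      by apply: le_trans; rewrite lerNl -normrN ler_norm.
    have e4 : gmax * (t * s k) <= gmax * B^-1 * t.
      by rewrite -mulrA ler_wpM2l// mulrC ler_wpM2r// ltW.
    have e5 : gamma k j / 2 * t ^+ 2 <= c2 + c3 * t by rewrite /c2 /c3; lra.
    have Bt2 : B * t <= B ^+ 2 * t ^+ 2.
      by rewrite -exprMn expr2 ler_peMl// mulr_ge0// ltW.
    have e6 : c2 <= c2 * B ^+ 2 * t ^+ 2.
      by rewrite -mulrA ler_peMr// (le_trans Bt1).
    have e7 : c3 * t <= c3 * B * t ^+ 2.
      rewrite -mulrA ler_wpM2l// expr2 mulrA ler_peMl//.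
    have t2 : 0 < t ^+ 2 by rewrite exprn_gt0// (lt_le_trans Bi0).
    have : gamma k j * t ^+ 2 <= G1 * t ^+ 2 by rewrite /G1; lra.
    by rewrite ler_pM2r// leNgt gG1.
  have td := trial_decrease B0 hB (ltnW jj) sB tB.
  have [_ _ _ /(_ j jj) rj _] := run k; apply: rj.
  apply/(line_search_testE _ _ gu).
  have MP : Phi k <= M k by apply: Phi_le_M; rewrite leq_subr leqnn.
  rewrite -/p -/t in td *.
  (* Young's inequality, with kap the coefficient of s k ^ 2 left unused by the
     test. *)
  have q1 : (gmax + B) * s k * t <=
      kap * s k ^+ 2 + (gmax + B) ^+ 2 / (4 * kap) * t ^+ 2.
    have := sqr_ge0 (2 * kap * s k - (gmax + B) * t).
    have -> : (2 * kap * s k - (gmax + B) * t) ^+ 2 = 4 * kap *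
      (kap * s k ^+ 2 + (gmax + B) ^+ 2 / (4 * kap) * t ^+ 2 -
      (gmax + B) * s k * t) by field; rewrite gt_eqF.
    by rewrite pmulr_rge0 ?mulr_gt0// subr_ge0.
  have q2 : 2 * (B + delta / 2 + (gmax + B) ^+ 2 / (4 * kap)) <=
      (1 - alpha) * gamma k j.
    by rewrite [X in _ <= X]mulrC -ler_pdivrMr// ltW.
  have := ler_wpM2r (sqr_ge0 t) q2.
  move: MP td q1; rewrite /Phi; rewrite {1}/kap; lra.
exists (Num.max gmax (rho * G)); first by rewrite le_max gm0.
have [_ [_ _ _ hs _]] := asymptotic_regularity.
apply: filterS (hs _ Bi0) => k sk; rewrite le_max.
case jE : (jk k) => [|j].
  by have [_ /andP[_ g1] _ _ _] := run k; rewrite /gamma expr0 mulr1 g1.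
apply/orP; right; rewrite /gamma exprSr mulrA mulrC ler_wpM2l//.
  by rewrite ltW// (lt_trans ltr01).
by apply: (rej k j sk); rewrite jE.
Qed.

(** Optimality of the accepted trial, once as an inclusion and once as a
comparison of values, with gamma replaced by its bound. *)
Lemma tail_estimates : exists N : nat, exists2 b : R, 0 <= b &
  forall k, (N <= k)%N ->
  (exists2 v, regular_subdiff ip g (x k.+1) v &
     `|gradf (x k.+1) + v| <= b * (s k.+1 + s k)) /\
  (forall c, edom g c ->
     fine (g (x k.+1)) <= fine (g c) + b * `|c - x k.+1| +
       b * (`|c - x k.+1| + (s k.+1 + s k)) ^+ 2).
Proof.
have [B B0 hB] := uniform_constant.
have Bi0 : 0 < B^-1 by rewrite invr_gt0.
have [G G0 hG] := stepsize_bounded.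
have [_ [_ _ _ hs _]] := asymptotic_regularity.
have [N _ hN] := filterI hG (hs _ Bi0).
exists N; exists (B + G + 1); first by rewrite !addr_ge0// ltW.
move=> k Nk; have [gG sk] := hN k Nk.
have [_ sk1] := hN k.+1 (leqW Nk).
have [_ _ opt _ [_ xE]] := run k.
have {opt} [Oy opt] := opt _ (leqnn _).
have [ffin _ _] := f_C1.
have gg : 0 <= gamma k (jk k) by apply: le_trans (gamma_ge _ _); exact: ltW.
have gne : edom g !=set0 by exists (x 0).
have [hO hL _ _] := hB _ (x_K k).
have yx := y_near k (jk k).
have uy : `|x k.+1 - y k (jk k)| <= s k.+1 + s k.
  rewrite -(subrK (x k) (x k.+1)) -addrA.
  by apply: le_trans (ler_normD _ _) _; rewrite lerD.
split.
  exists (- gradf (y k (jk k)) - gamma k (jk k) *: (x k.+1 - y k (jk k))).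
    rewrite xE; apply: prox_regular_subdiff => //; first exact: ffin.
    exact: g_gtNy.
  rewrite addrA; apply: le_trans (ler_normB _ _) _.
  have h1 := hL (x k.+1) (y k (jk k)) sk1.
  rewrite distrC in yx; have {h1} h1 := h1 (le_lt_trans yx sk).
  rewrite normrZ ger0_norm//.
  apply: le_trans (_ : (B + G) * `|x k.+1 - y k (jk k)| <= _).
    by rewrite mulrDl lerD// ler_wpM2r.
  apply: ler_pM => //; first by rewrite addr_ge0// ltW.
  by rewrite lerDl.
move=> c gc; have [_ pr] := trial_prox (leqnn (jk k)).
have {pr} := pr c gc; rewrite -xE.
have cu : `|c - y k (jk k)| <= `|c - x k.+1| + (s k.+1 + s k).
  rewrite -(subrK (x k.+1) c) -addrA.
  apply: le_trans (ler_normD _ _) _; first by rewrite addrK lerD.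
have cu2 : `|c - y k (jk k)| ^+ 2 <= (`|c - x k.+1| + (s k.+1 + s k)) ^+ 2.
  by rewrite !expr2; apply: ler_pM.
set D := (`|c - x k.+1| + (s k.+1 + s k)) ^+ 2 in cu2 *.
have D0 : 0 <= D by exact: sqr_ge0.
have e1 : ip (gradf (y k (jk k))) (c - x k.+1) <= (B + G + 1) * `|c - x k.+1|.
  apply: le_trans (ip_le_norm ip_norm _ _) _; rewrite ler_wpM2r//.
  by apply: le_trans (gradf_y_le _ B0 hB sk) _; rewrite lerD2r lerDl.
have e2 : gamma k (jk k) / 2 * `|c - y k (jk k)| ^+ 2 <= (B + G + 1) * D.
  apply: le_trans (_ : gamma k (jk k) / 2 * D <= _).
    by rewrite ler_wpM2l// divr_ge0.
  by rewrite ler_wpM2r//; move: gG B0 gg; lra.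
have e3 : 0 <= gamma k (jk k) / 2 * `|x k.+1 - y k (jk k)| ^+ 2.
  by rewrite mulr_ge0 ?sqr_ge0// divr_ge0.
move: e1 e2 e3; rewrite !(ipDr ip) !(ipNr ip); lra.
Qed.

Hypothesis Fdelta_KL : KL_function (ip_prod ip) (Fdelta F delta).

Lemma convergence_of_run : exists xs : X,
  [/\ zseq x k @[k --> \oo] --> (xs, xs), stationary ip g gradf xs &
    forall theta : R, 2^-1 <= theta -> theta < 1 ->
      KL_function_exponent ip theta F ->
      exists C q : R, [/\ 0 < C, 0 < q, q < 1 &
        \forall k \near \oo,
          ((`|x k - xs|)%:E <= \sum_(k <= j <oo) (`|x j.+1 - x j|)%:E)%E /\
          (\sum_(k <= j <oo) (`|x j.+1 - x j|)%:E <=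
             (if theta == 2^-1 then C * q ^+ k
              else C * k%:R `^ ((1 - theta) / (1 - 2 * theta)))%:E)%E]].
Proof.
have [Ms [Ms_le M_cvg Phi_cvg s_small [C C0 window_steps]]] :=
  asymptotic_regularity.
have s_cvg0 : s k @[k --> \oo] --> 0.
  apply/cvgrPdist_lt => e e0; apply: filterS (s_small e e0) => k.
  by rewrite sub0r normrN ger0_norm// s_ge0.
have [N [b b0 est]] := tail_estimates.
have /choice[v hv] : forall k, exists v, (N <= k)%N ->
    regular_subdiff ip g (x k.+1) v /\
    `|gradf (x k.+1) + v| <= b * (s k.+1 + s k).
  move=> k; have [Nk|//] := leqP N k; last by exists 0.
  by have [[v v1 v2] _] := est k Nk; exists v.
have F_lsc : lower_semicontinuous F.
  apply: lower_semicontinuous_add => //; first by case: f_proper.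
  exact: g_gtNy.
apply: (convergence_with_rate (N := N) (v := v) ip_norm O_open
  dom_g_O f_C1 g_gtNy F_lsc
  (ltW delta_gt0) x_dom K_compact K_dom x_K Phi_cvg s_cvg0 b0 _ _ _ Fdelta_KL
  a_gt0 Phi_le_M M_attained descent M_cvg Ms_le C0 window_steps).
- by move=> k /hv[].
- by move=> k /hv[].
- by move=> k c Nk; have [_ +] := est k Nk; apply.
Qed.

End Method.

(** * Reduction to a positive penalty *)

(** The multiples of a nonzero vector would make the fibre over x0 unbounded.
*)
Lemma bounded_fibre_trivial (R : realType) (X : normedModType R)
    (A : set (X * X)) (x0 : X) :
  bounded_set A -> (forall v, A (x0, v)) -> forall u : X, u = 0.
Proof.
move=> [B [_ hB]] A0 u; apply/eqP; apply: contraT => u0.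
have nu : 0 < `|u| by rewrite normr_gt0.
pose t := (`|B| + 2) / `|u|.
have := hB (`|B| + 1) _ (x0, t *: u) (A0 _).
have -> : B < `|B| + 1 by rewrite ltr_pwDr// ler_norm.
move=> /(_ isT) /=; rewrite prod_normE/= ge_max => /andP[_].
rewrite normrZ ger0_norm ?divr_ge0 ?addr_ge0// /t divfK ?gt_eqF//; lra.
Qed.
Section TrivialSpace.
Variables (R : realType) (X : normedModType R).
Hypothesis X0 : forall u : X, u = 0.

Lemma Fdelta_trivial (F : X -> \bar R) (d1 d2 : R) : Fdelta F d1 = Fdelta F d2.
Proof.
by apply/funext => z; rewrite /Fdelta [z.1 - z.2]X0 normr0 expr0n/= !mulr0.
Qed.

Lemma line_search_test_trivial (F : X -> \bar R) m (d1 d2 alpha : R) :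
  line_search_test F m d1 alpha = line_search_test F m d2 alpha.
Proof.
apply/funext => x; apply/funext => k; apply/funext => gamma; apply/funext => u.
rewrite /line_search_test (Fdelta_trivial F d1 d2) [x k - _]X0.
by rewrite normr0 expr0n/= !mulr0.
Qed.

End TrivialSpace.

Theorem theorem10 (R : realType) (X : normedModType R)
    (n : nat) (Xfin : Vector.axiom n X)
    (ip : {dot X for idfun})
    (ip_norm : forall x : X, `|x| = Num.sqrt (ip x x))
    (f g : X -> \bar R) (O : set X) (gradf : X -> X)
    (f_proper : proper_fun f) (f_lsc : lower_semicontinuous f)
    (O_open : open O) (dom_g_O : edom g `<=` O) (dom_g_neq0 : edom g !=set0)
    (f_C1 : continuously_differentiable_on ip O f gradf)
    (gradf_lip : strictly_continuous_on O gradf)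
    (g_proper : proper_fun g) (g_lsc : lower_semicontinuous g)
    (g_bnd : bounded_below g)
    (F_bnd : bounded_below (fun x => (f x + g x)%E))
    (m : nat) (delta alpha gmin gmax bmax rho nu : R)
    (delta_ge0 : 0 <= delta)
    (alpha_gt0 : 0 < alpha) (alpha_lt1 : alpha < 1)
    (gmin_gt0 : 0 < gmin) (gmin_le_gmax : gmin <= gmax)
    (bmax_ge0 : 0 <= bmax) (bmax_le1 : bmax <= 1)
    (rho_gt1 : 1 < rho) (nu_gt0 : 0 < nu) (nu_lt : nu < rho^-1)
    (x : nat -> X) (x0_dom : edom g (x 0%N))
    (x_gen : generated_by_method ip f g gradf O m delta alpha
               gmin gmax bmax rho nu x)
    (level_bounded : bounded_set
       [set z : X * X | (Fdelta (fun u => (f u + g u)%E) delta z <=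
                         Fdelta (fun u => (f u + g u)%E) delta (zseq x 0))%E])
    (Fdelta_KL : KL_function (ip_prod ip)
                   (Fdelta (fun u => (f u + g u)%E) delta)) :
  exists xs : X,
    [/\ zseq x k @[k --> \oo] --> (xs, xs),
        stationary ip g gradf xs &
        forall theta : R, 2^-1 <= theta -> theta < 1 ->
          KL_function_exponent ip theta (fun u => (f u + g u)%E) ->
          exists C q : R,
            [/\ 0 < C, 0 < q, q < 1 &
                \forall k \near \oo,
                  ((`|x k - xs|)%:E <=
                     \sum_(k <= j <oo) (`|x j.+1 - x j|)%:E)%E /\
                  (\sum_(k <= j <oo) (`|x j.+1 - x j|)%:E <=
                     (if theta == 2^-1 then C * q ^+ k
                      else C * k%:R `^ ((1 - theta) / (1 - 2 * theta)))%:E)%E]].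
Proof.
have [d [d_gt0 dlev dKL dgen]] : exists d, [/\ 0 < d,
    bounded_set [set z : X * X | (Fdelta (fun u => (f u + g u)%E) d z <=
      Fdelta (fun u => (f u + g u)%E) d (zseq x 0))%E],
    KL_function (ip_prod ip) (Fdelta (fun u => (f u + g u)%E) d) &
    generated_by_method ip f g gradf O m d alpha gmin gmax bmax rho nu x].
  have [d_gt0|d_le0] := ltP 0 delta; first by exists delta.
  have d0 : delta = 0 by apply/eqP; rewrite eq_le d_le0.
  (* The level set contains the fibre over x 0, as there is no penalty. *)
  have X0 : forall u : X, u = 0.
    apply: (bounded_fibre_trivial (x0 := x 0%N) level_bounded) => v /=.
    by rewrite /Fdelta/= d0 mul0r !mul0r.
  exists 1; split; rewrite ?(Fdelta_trivial X0 _ 1 delta)//.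
  move: x_gen; rewrite /generated_by_method.
  by rewrite (line_search_test_trivial X0 _ _ 1 delta).
have [beta0 [gamma0 [xt [jk run]]]] := dgen.
exact: (convergence_of_run Xfin ip_norm f_proper f_lsc O_open dom_g_O f_C1
  gradf_lip g_proper g_lsc g_bnd F_bnd d_gt0 alpha_gt0 alpha_lt1 gmin_gt0
  bmax_le1 rho_gt1 nu_gt0 nu_lt x0_dom run dlev dKL).
Qed.
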